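(* Let $H$ be a group object in the topos $\mathscr{T}$ acting freely on an object $X$, with quotient $Q=X/H^{\mathrm{op}}$, and let $g:S\to Q$ be an $S$-valued point. Put $P=g^*(X)=X\times_Q S$, and let $\tilde H=P\wedge^H H$ and $\tilde X=\underline{\mathrm{Isom}}_{H_Q}(P_Q,X)$ be the twisted forms described in the context, so that $\tilde X/\tilde H^{\mathrm{op}}=Q$. Then with respect to the quotient $Q=\tilde X/\tilde H^{\mathrm{op}}$, the given $S$-valued point $g:S\to Q$ is of geometric origin.
   Context: Let $\mathcal{C}$ be a site that contains a terminal object $S$, in which all fiber products exist, and for which all representable functors satisfy the sheaf axiom. Let $\mathscr{T}=\mathrm{Sh}(\mathcal{C})$ be the topos of sheaves; via Yoneda $\mathcal{C}\subset\mathscr{T}$, and $S$ is terminal in $\mathscr{T}$. All objects are in $\mathscr{T}$ unless said otherwise. Group objects act from the left. For a group object $G$, a $G$-torsor is an object with $G$-action that is locally isomorphic to $G$ with left multiplication. If $P$ is a $G$-torsor and $Z$ is an object with $G$-action, the twisted form is ${}^P\!Z=P\wedge^G Z=G\backslash(P\times Z)$, where $G$ acts diagonally on $P\times Z$. If $Z$ is a group object on which $G$ acts by group automorphisms, ${}^P\!Z$ is again a group object. The notation $X/H^{\mathrm{op}}$ means $H\backslash X$ (quotient sheaf). When $H$ acts freely on $X$ with $Q=X/H^{\mathrm{op}}$, the comma category $\mathscr{T}_{/Q}$ is a topos, $H_Q=H\times Q$ is a group object in it, and $X$ is an $H_Q$-torsor in $\mathscr{T}_{/Q}$. Given $g:S\to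 Q$, the pullback $g^*(X)=X\times_Q S$ is an $H$-torsor. One says that $g$ is of *geometric origin* (with respect to the quotient $Q=X/H^{\mathrm{op}}$) if the $H$-torsor $g^*(X)$ is trivial; equivalently, $g$ lies in the image of $X(S)\to Q(S)$. For $P=g^*(X)$, the twisted form $\tilde H=P\wedge^H H={}^P\!H$ is formed with respect to the conjugation action of $H$ on itself. Write $P_Q=P\times Q$, which is an $H_Q$-torsor in $\mathscr{T}_{/Q}$, and let $\tilde X=\underline{\mathrm{Isom}}_{H_Q}(P_Q,X)$ be the object over $Q$ of $H_Q$-equivariant isomorphisms. The automorphism group object of the $H$-torsor $P$ is $({}^P\!H)^{\mathrm{op}}$; via its action on $P_Q$, $\tilde X$ becomes a torsor over $Q$ for $\tilde H_Q=\tilde H\times Q$. Hence $\tilde H$ acts freely on $\tilde X$ with quotient $\tilde X/\tilde H^{\mathrm{op}}=Q$. *)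

(* Defs.v *)
From Stdlib Require Import ssreflect FunctionalExtensionality PropExtensionality.
From Stdlib Require Import ProofIrrelevance ClassicalEpsilon.

Set Implicit Arguments.
Unset Strict Implicit.
Unset Printing Implicit Defensive.

(** * Sites *)

Record category := Category {
  Ob :> Type;
  Hom : Ob -> Ob -> Type;
  idm : forall U, Hom U U;
  compm : forall U V W, Hom V W -> Hom U V -> Hom U W;
  comp1m : forall U V (f : Hom U V), compm (idm V) f = f;
  compm1 : forall U V (f : Hom U V), compm f (idm U) = f;
  compmA : forall T U V W (f : Hom V W) (g : Hom U V) (h : Hom T U),
    compm f (compm g h) = compm (compm f g) h }.

Arguments idm {c} U.
Arguments Hom {c} _ _.
Notation "f ∘ g" := (compm f g) (at level 40, left associativity).

Definition is_terminal (C : category) (S : C) : Prop :=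
  forall U : C, exists! f : Hom U S, True.

Definition has_fiber_products (C : category) : Prop :=
  forall (U V W : C) (f : Hom U W) (g : Hom V W),
  exists (P : C) (p : Hom P U) (q : Hom P V),
    f ∘ p = g ∘ q /\
    forall (T : C) (s : Hom T U) (t : Hom T V), f ∘ s = g ∘ t ->
      exists! h : Hom T P, p ∘ h = s /\ q ∘ h = t.

Record sieve (C : category) (U : C) := Sieve {
  mem : forall V, Hom V U -> Prop;
  mem_comp : forall V W (f : Hom V U) (k : Hom W V), mem f -> mem (f ∘ k) }.

Arguments mem {C U} s {V} f.

Definition pull_sieve (C : category) (U V : C) (R : sieve U)
    (f : Hom V U) : sieve V.
Proof.
unshelve refine {| mem := fun W k => mem R (f ∘ k) |}.
by move=> W T k l /= H; rewrite compmA; apply: mem_comp.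
Defined.

(* A sieve is maximal iff it contains the identity. *)
Record site := Site {
  site_cat :> category;
  covers : forall U : site_cat, sieve U -> Prop;
  covers_max : forall (U : site_cat) (R : sieve U), mem R (idm U) -> covers R;
  covers_pull : forall (U V : site_cat) (R : sieve U) (f : Hom V U),
    covers R -> covers (pull_sieve R f);
  covers_trans : forall (U : site_cat) (R R' : sieve U), covers R ->
    (forall V (f : Hom V U), mem R f -> covers (pull_sieve R' f)) -> covers R' }.

(** * Sheaves *)

Record presheaf (C : category) := Presheaf {
  sec :> C -> Type;
  res : forall U V (f : Hom V U), sec U -> sec V;
  res_id : forall U (x : sec U), res (idm U) x = x;
  res_comp : forall U V W (f : Hom V U) (k : Hom W V) (x : sec U),
    res (f ∘ k) x = res k (res f x) }.

Arguments res {C p U V} f x.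

Definition sheaf_axiom (C : site) (F : presheaf C) : Prop :=
  forall (U : C) (R : sieve U), covers R ->
  forall s : (forall V (f : Hom V U), mem R f -> F V),
    (forall V W (f : Hom V U) (k : Hom W V) (hf : mem R f) (hfk : mem R (f ∘ k)),
       res k (s V f hf) = s W (f ∘ k) hfk) ->
    exists! x : F U, forall V (f : Hom V U) (hf : mem R f), res f x = s V f hf.

Record sheaf (C : site) := Sheaf {
  psh :> presheaf C;
  sheafP : sheaf_axiom psh }.

Record mor (C : site) (X Y : sheaf C) := Mor {
  app : forall U, X U -> Y U;
  app_res : forall U V (f : Hom V U) (x : X U), app (res f x) = res f (app x) }.

Arguments app {C X Y} m {U} x.
Notation "X ~> Y" := (mor X Y) (at level 70, no associativity).

Definition mid (C : site) (X : sheaf C) : X ~> X.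
Proof.
unshelve refine {| app := fun U x => x |}.
by [].
Defined.

Definition mcomp (C : site) (X Y Z : sheaf C) (g : Y ~> Z) (f : X ~> Y) :
  X ~> Z.
Proof.
unshelve refine {| app := fun U x => app g (app f x) |}.
by move=> *; rewrite !app_res.
Defined.

Definition is_iso (C : site) (X Y : sheaf C) (f : X ~> Y) : Prop :=
  exists g : Y ~> X, mcomp g f = mid X /\ mcomp f g = mid Y.

Definition representable (C : category) (S : C) : presheaf C.
Proof.
refine {| sec := fun U => Hom U S; res := fun U V f x => x ∘ f |}.
- by move=> U x; rewrite compm1.
- by move=> U V W f k x; rewrite compmA.
Defined.

Definition subcanonical (C : site) : Prop :=
  forall S : C, sheaf_axiom (representable S).

Definition yo (C : site) (sub : subcanonical C) (S : C) : sheaf C := Sheaf (sub S).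

Definition yo_point (C : site) (sub : subcanonical C) (F : sheaf C) (U : C)
    (x : F U) : yo sub U ~> F.
Proof.
unshelve refine {| app := fun V (f : yo sub U V) => res (f : Hom V U) x |}.
by move=> * /=; rewrite res_comp.
Defined.


Definition locally (C : site) (U : C) (Pr : forall V, Hom V U -> Prop) : Prop :=
  exists R : sieve U, covers R /\ forall V (f : Hom V U), mem R f -> Pr V f.

Section Locally.
Variable C : site.
Implicit Types (U V W : C).

Lemma locally_now U (Pr : forall V, Hom V U -> Prop) :
  (forall V (f : Hom V U), Pr V f) -> locally Pr.
Proof.
move=> H; exists (@Sieve C U (fun _ _ => True) (fun _ _ _ _ _ => I)).
by split=> //; apply: covers_max.
Qed.

Lemma locally_pull U V (f : Hom V U) (Pr : forall V, Hom V U -> Prop) :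
  locally Pr -> locally (fun W (k : Hom W V) => Pr W (f ∘ k)).
Proof.
move=> [R [cR HR]]; exists (pull_sieve R f); split; first exact: covers_pull.
by move=> W k /HR.
Qed.

Lemma locally_bind U (Pr Pr' : forall V, Hom V U -> Prop) :
  locally Pr ->
  (forall V (f : Hom V U), Pr V f -> locally (fun W (k : Hom W V) => Pr' W (f ∘ k))) ->
  locally Pr'.
Proof.
move=> [R [cR HR]] H.
pose R' := @Sieve C U (fun V f => forall W (k : Hom W V), Pr' W (f ∘ k))
  (fun V W f k Hf T l => eq_ind _ (Pr' T) (Hf T (k ∘ l)) _ (compmA f k l)).
exists R'; split; last first.
  by move=> V f /(_ _ (idm V)); rewrite compm1.
apply: (covers_trans cR) => V f Rf.
have [R1 [cR1 H1]] := H V f (HR V f Rf).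
apply: (covers_trans cR1) => W k R1k; apply: covers_max => T l.
by rewrite compm1 -!compmA; apply: H1; apply: mem_comp.
Qed.

Lemma locally_and U (P1 P2 : forall V, Hom V U -> Prop) :
  (forall V W (f : Hom V U) (k : Hom W V), P1 V f -> P1 W (f ∘ k)) ->
  locally P1 -> locally P2 -> locally (fun V f => P1 V f /\ P2 V f).
Proof.
move=> st l1 l2; apply: (locally_bind l1) => V f H1.
have [R [cR HR]] := locally_pull f l2.
by exists R; split=> // W k /HR H2; split=> //; apply: st.
Qed.

Lemma locally_imp U (P1 P2 : forall V, Hom V U -> Prop) :
  (forall V f, P1 V f -> P2 V f) -> locally P1 -> locally P2.
Proof. by move=> H [R [cR HR]]; exists R; split=> // V f /HR /H. Qed.

Lemma sheaf_sep (F : sheaf C) U (x y : F U) :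
  locally (fun V (f : Hom V U) => res f x = res f y) -> x = y.
Proof.
move=> [R [cR HR]].
have [|z [_ uz]] := @sheafP C F U R cR (fun V f _ => res f x).
  by move=> V W f k _ _; rewrite res_comp.
by rewrite -(uz x) // -(uz y) // => V f /HR.
Qed.

Lemma sheaf_glue (F : sheaf C) U (D : forall V, Hom V U -> F V -> Prop) :
  (forall V W (f : Hom V U) (k : Hom W V) x, D V f x -> D W (f ∘ k) (res k x)) ->
  (forall V (f : Hom V U) x y, D V f x -> D V f y -> x = y) ->
  locally (fun V (f : Hom V U) => exists x, D V f x) ->
  exists! z : F U, forall V (f : Hom V U) x, D V f x -> res f z = x.
Proof.
move=> st fu lo; have [R [cR HR]] := lo.
pose s V (f : Hom V U) (h : mem R f) :=
  proj1_sig (constructive_indefinite_description _ (HR V f h)).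
have sP V f h : D V f (s V f h).
  exact: (proj2_sig (constructive_indefinite_description _ (HR V f h))).
have [|z [hz uz]] := @sheafP C F U R cR s.
  by move=> V W f k hf hfk; apply: (fu _ (f ∘ k)) (sP _ _ _); apply: st.
exists z; split.
  move=> V f x Dx; apply: sheaf_sep.
  apply: (locally_imp _ (locally_pull f (ex_intro _ R (conj cR (fun V f h => h))))).
  move=> W k Rfk; rewrite -res_comp (hz _ _ Rfk).
  by apply: (fu _ (f ∘ k)) (sP _ _ _) _; apply: st.
move=> z' hz'; apply: uz => V f hf; exact/hz'/sP.
Qed.

Lemma mor_ext (X Y : sheaf C) (f g : X ~> Y) :
  (forall U (x : X U), app f x = app g x) -> f = g.
Proof.
case: f g => [f hf] [g hg] /= E.
have {}E : f = g.
  by apply: functional_extensionality_dep => U; apply: functional_extensionality => x; apply: E.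
by case: _ / E hg => hg; rewrite (proof_irrelevance _ hf hg).
Qed.

Lemma bij_is_iso (X Y : sheaf C) (f : X ~> Y) :
  (forall U (x x' : X U), app f x = app f x' -> x = x') ->
  (forall U (y : Y U), exists x, app f x = y) -> is_iso f.
Proof.
move=> inj sur.
pose g U (y : Y U) := proj1_sig (constructive_indefinite_description _ (sur U y)).
have gP U y : app f (g U y) = y.
  exact: (proj2_sig (constructive_indefinite_description _ (sur U y))).
have gN U V (k : Hom V U) (y : Y U) : g V (res k y) = res k (g U y).
  by apply: inj; rewrite app_res !gP.
exists (Mor gN); split; apply: mor_ext => U x /=; last exact: gP.
by apply: inj; rewrite gP.
Qed.

Lemma is_iso_inj (X Y : sheaf C) (f : X ~> Y) (hf : is_iso f) U (x x' : X U) :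
  app f x = app f x' -> x = x'.
Proof.
move=> E; have [g [gf _]] := hf.
by rewrite -[x]/(app (mid X) x) -[x']/(app (mid X) x') -gf /= E.
Qed.

Lemma is_iso_surj (X Y : sheaf C) (f : X ~> Y) (hf : is_iso f) U (y : Y U) :
  exists x, app f x = y.
Proof.
have [g [_ fg]] := hf; exists (app g y).
by rewrite -[RHS]/(app (mid Y) y) -fg.
Qed.

End Locally.

Section Descent.
Variables (C : site) (A B Z : sheaf C) (e : A ~> B) (h : A ~> Z).
Hypothesis e_surj : forall U (b : B U),
  locally (fun V (f : Hom V U) => exists a, app e a = res f b).
Hypothesis e_h : forall U (a a' : A U), app e a = app e a' -> app h a = app h a'.

Lemma descend_ex U (b : B U) :
  exists! z : Z U, forall V (f : Hom V U) x,
    (exists a, app e a = res f b /\ x = app h a) -> res f z = x.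
Proof.
apply: sheaf_glue.
- move=> V W f k x [a [ea ->]]; exists (res k a).
  by rewrite app_res ea res_comp app_res.
- by move=> V f x y [a [ea ->]] [a' [ea' ->]]; apply: e_h; rewrite ea ea'.
- by apply: (locally_imp _ (e_surj b)) => V f [a ea]; exists (app h a), a.
Qed.

Definition descend_app U (b : B U) : Z U :=
  proj1_sig (constructive_indefinite_description _ (descend_ex b)).

Lemma descend_app_e U V (f : Hom V U) (b : B U) a :
  app e a = res f b -> res f (descend_app b) = app h a.
Proof.
move=> E; rewrite /descend_app.
case: constructive_indefinite_description => z [hz _] /=.
by apply: hz; exists a.
Qed.

Lemma descend_nat U V (f : Hom V U) (b : B U) :
  descend_app (res f b) = res f (descend_app b).
Proof.
apply: sheaf_sep; apply: (locally_imp _ (e_surj (res f b))) => W k [a E].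
rewrite (descend_app_e E) -res_comp; symmetry; apply: descend_app_e.
by rewrite E res_comp.
Qed.

Definition descend : B ~> Z := Mor descend_nat.

Lemma descendE U (a : A U) : app descend (app e a) = app h a.
Proof. by rewrite -[LHS]res_id; apply: descend_app_e; rewrite res_id. Qed.

End Descent.

(** ** Finite limits *)

Lemma glue_fun (C : site) (F : sheaf C) (U : C) (R : sieve U) (cR : covers R)
    (s : forall V (f : Hom V U), mem R f -> F V) :
  (forall V W (f : Hom V U) (k : Hom W V) (hf : mem R f) (hfk : mem R (f ∘ k)),
       res k (s V f hf) = s W (f ∘ k) hfk) ->
  exists x : F U, forall V (f : Hom V U) (hf : mem R f), res f x = s V f hf.
Proof. by move=> /(sheafP cR) [x [hx _]]; exists x. Qed.

Lemma sheaf_axiomI (C : site) (F : presheaf C) :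
  (forall (U : C) (x y : F U),
     locally (fun V (f : Hom V U) => res f x = res f y) -> x = y) ->
  (forall (U : C) (R : sieve U), covers R ->
   forall s : (forall V (f : Hom V U), mem R f -> F V),
    (forall V W (f : Hom V U) (k : Hom W V) (hf : mem R f) (hfk : mem R (f ∘ k)),
       res k (s V f hf) = s W (f ∘ k) hfk) ->
    exists x : F U, forall V (f : Hom V U) (hf : mem R f), res f x = s V f hf) ->
  sheaf_axiom F.
Proof.
move=> sep glue U R cR s /(glue U R cR) [x hx]; exists x; split=> // y hy.
by apply: sep; exists R; split=> // V f hf; rewrite (hx _ _ hf) hy.
Qed.

Definition unit_psh (C : category) : presheaf C.
Proof. by refine {| sec := fun _ => unit; res := fun _ _ _ x => x |}. Defined.

Lemma unit_sheaf_axiom (C : site) : sheaf_axiom (unit_psh C).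
Proof.
apply: sheaf_axiomI; first by move=> U [] [].
by move=> U R _ s _; exists tt => V f hf; case: (s V f hf).
Qed.

Definition unit_sheaf (C : site) : sheaf C := Sheaf (@unit_sheaf_axiom C).

Definition prod_psh (C : category) (X Y : presheaf C) : presheaf C.
Proof.
refine {| sec := fun U => (X U * Y U)%type;
          res := fun U V f z => (res f (fst z), res f (snd z)) |}.
- by move=> U [x y] /=; rewrite !res_id.
- by move=> U V W f k [x y] /=; rewrite !res_comp.
Defined.

Lemma prod_sheaf_axiom (C : site) (X Y : sheaf C) : sheaf_axiom (prod_psh X Y).
Proof.
apply: sheaf_axiomI => [U [x y] [x' y'] /= H|U R cR s hs].
  by congr pair; apply: sheaf_sep; apply: (locally_imp _ H) => V f [].
have [|x hx] := @glue_fun C X U R cR (fun V f h => fst (s V f h)).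
  by move=> V W f k hf hfk; rewrite -(hs V W f k hf hfk).
have [|y hy] := @glue_fun C Y U R cR (fun V f h => snd (s V f h)).
  by move=> V W f k hf hfk; rewrite -(hs V W f k hf hfk).
by exists (x, y) => V f h /=; rewrite (hx _ _ h) (hy _ _ h); case: (s V f h).
Qed.

Definition prod_sheaf (C : site) (X Y : sheaf C) : sheaf C := Sheaf (@prod_sheaf_axiom C X Y).
Notation "X × Y" := (prod_sheaf X Y) (at level 40, left associativity).

Definition pr2 (C : site) (X Y : sheaf C) : X × Y ~> Y.
Proof.
unshelve refine {| app := fun U (z : (X × Y) U) => snd z |}.
by [].
Defined.

Lemma sig_ext (T : Type) (Pr : T -> Prop) (x y : {z | Pr z}) :
  proj1_sig x = proj1_sig y -> x = y.
Proof.
by case: x y => [x hx] [y hy] /= E; subst y; rewrite (proof_irrelevance _ hx hy).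
Qed.

Section FiberProduct.
Variables (C : site) (X T Q : sheaf C) (q : X ~> Q) (t : T ~> Q).

Definition fib_sec (U : C) : Type := {z : X U * T U | app q (fst z) = app t (snd z)}.

Lemma fib_res_proof U V (f : Hom V U) (z : fib_sec U) :
  app q (res f (fst (proj1_sig z))) = app t (res f (snd (proj1_sig z))).
Proof. by rewrite !app_res (proj2_sig z). Qed.

Definition fib_psh : presheaf C.
Proof.
refine {| sec := fib_sec;
  res := fun U V f z => exist _ (res f (fst (proj1_sig z)), res f (snd (proj1_sig z)))
                                (fib_res_proof f z) |}.
- by move=> U [[x y] e]; apply: sig_ext => /=; rewrite !res_id.
- by move=> U V W f k [[x y] e]; apply: sig_ext => /=; rewrite !res_comp.
Defined.

Lemma fib_sheaf_axiom : sheaf_axiom fib_psh.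
Proof.
apply: sheaf_axiomI => [U [[x y] e] [[x' y'] e'] H|U R cR s hs].
  apply: sig_ext => /=; congr pair; apply: sheaf_sep;
    by apply: (locally_imp _ H) => V f /(f_equal (@proj1_sig _ _)) [].
have [|x hx] := @glue_fun C X U R cR (fun V f h => fst (proj1_sig (s V f h))).
  by move=> V W f k hf hfk; rewrite -(hs V W f k hf hfk).
have [|y hy] := @glue_fun C T U R cR (fun V f h => snd (proj1_sig (s V f h))).
  by move=> V W f k hf hfk; rewrite -(hs V W f k hf hfk).
have E : app q x = app t y.
  apply: sheaf_sep; exists R; split=> // V f h.
  by rewrite -!app_res (hx _ _ h) (hy _ _ h) (proj2_sig (s V f h)).
exists (exist _ (x, y) E) => V f h; apply: sig_ext => /=.
by rewrite (hx _ _ h) (hy _ _ h); case: (proj1_sig _).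
Qed.

Definition fib_prod : sheaf C := Sheaf fib_sheaf_axiom.

Definition fib_pr1 : fib_prod ~> X.
Proof.
unshelve refine {| app := fun U (z : fib_prod U) => fst (proj1_sig z) |}.
by [].
Defined.

Definition fib_pr2 : fib_prod ~> T.
Proof.
unshelve refine {| app := fun U (z : fib_prod U) => snd (proj1_sig z) |}.
by [].
Defined.

End FiberProduct.

(** * Group objects and actions *)

Record group_object (C : site) := GroupObject {
  gcar :> sheaf C;
  gmul : gcar × gcar ~> gcar;
  gone : unit_sheaf C ~> gcar;
  ginv : gcar ~> gcar;
  gmulA : forall (U : C) (x y z : gcar U),
    app gmul (x, app gmul (y, z)) = app gmul (app gmul (x, y), z);
  gmul1g : forall (U : C) (x : gcar U), app gmul (app gone (tt : unit_sheaf C U), x) = x;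
  gmulg1 : forall (U : C) (x : gcar U), app gmul (x, app gone (tt : unit_sheaf C U)) = x;
  gmulVg : forall (U : C) (x : gcar U),
    app gmul (app ginv x, x) = app gone (tt : unit_sheaf C U);
  gmulgV : forall (U : C) (x : gcar U),
    app gmul (x, app ginv x) = app gone (tt : unit_sheaf C U) }.

Definition mulg (C : site) (G : group_object C) (U : C) (x y : G U) : G U :=
  app (gmul G) (x, y).
Definition oneg (C : site) (G : group_object C) (U : C) : G U :=
  app (gone G) (tt : unit_sheaf C U).
Definition invg (C : site) (G : group_object C) (U : C) (x : G U) : G U :=
  app (ginv G) x.
Arguments oneg {C G U}.

Declare Scope grp_scope.
Delimit Scope grp_scope with G.
Notation "x * y" := (mulg x y) : grp_scope.
Notation "1" := oneg : grp_scope.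
Notation "x ^-1" := (invg x) (at level 3, left associativity, format "x ^-1") : grp_scope.
Local Open Scope grp_scope.

Section GroupTheory.
Variables (C : site) (G : group_object C) (U : C).
Implicit Types x y z : G U.
Lemma mulgA x y z : x * (y * z) = x * y * z. Proof. exact: gmulA. Qed.
Lemma mul1g x : 1 * x = x. Proof. exact: gmul1g. Qed.
Lemma mulg1 x : x * 1 = x. Proof. exact: gmulg1. Qed.
Lemma mulVg x : x^-1 * x = 1. Proof. exact: gmulVg. Qed.
Lemma mulgV x : x * x^-1 = 1. Proof. exact: gmulgV. Qed.
Lemma mulKg x y : x^-1 * (x * y) = y. Proof. by rewrite mulgA mulVg mul1g. Qed.
Lemma mulVKg x y : x * (x^-1 * y) = y. Proof. by rewrite mulgA mulgV mul1g. Qed.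
Lemma mulgK x y : x * y * y^-1 = x. Proof. by rewrite -mulgA mulgV mulg1. Qed.
Lemma mulgVK x y : x * y^-1 * y = x. Proof. by rewrite -mulgA mulVg mulg1. Qed.
Lemma mulgI x y z : x * y = x * z -> y = z.
Proof. by move=> E; rewrite -(mulKg x y) E mulKg. Qed.
Lemma mulIg x y z : y * x = z * x -> y = z.
Proof. by move=> E; rewrite -(mulgK y x) E mulgK. Qed.
Lemma invMg x y : (x * y)^-1 = y^-1 * x^-1.
Proof. by apply: (@mulgI (x * y)); rewrite mulgV mulgA mulgK mulgV. Qed.
Lemma inv1g : (1 : G U)^-1 = 1.
Proof. by apply: (@mulgI 1); rewrite mulgV mulg1. Qed.
Lemma invgK x : (x^-1)^-1 = x.
Proof. by apply: (@mulgI x^-1); rewrite mulgV mulVg. Qed.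
Lemma res_mulg V (f : Hom V U) x y : res f (x * y) = res f x * res f y.
Proof. by rewrite /mulg -app_res. Qed.
Lemma res_oneg V (f : Hom V U) : res f (1 : G U) = 1.
Proof. by rewrite /oneg -app_res. Qed.
Lemma res_invg V (f : Hom V U) x : res f x^-1 = (res f x)^-1.
Proof. by rewrite /invg -app_res. Qed.
End GroupTheory.

Record gobject (C : site) (G : group_object C) := GObject {
  gobj :> sheaf C;
  gact : G × gobj ~> gobj;
  gact1 : forall (U : C) (x : gobj U), app gact (1 : G U, x) = x;
  gactM : forall (U : C) (g h : G U) (x : gobj U),
    app gact (g * h, x) = app gact (g, app gact (h, x)) }.

Definition actg (C : site) (G : group_object C) (X : gobject G) (U : C)
    (g : G U) (x : X U) : X U := app (gact X) (g, x).
Notation "g • x" := (actg g x) (at level 40, left associativity) : grp_scope.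

Section ActionTheory.
Variables (C : site) (G : group_object C) (X : gobject G) (U : C).
Implicit Types (g h : G U) (x : X U).
Lemma act1 x : (1 : G U) • x = x. Proof. exact: gact1. Qed.
Lemma actM g h x : (g * h) • x = g • (h • x). Proof. exact: gactM. Qed.
Lemma actK g x : g^-1 • (g • x) = x. Proof. by rewrite -actM mulVg act1. Qed.
Lemma actVK g x : g • (g^-1 • x) = x. Proof. by rewrite -actM mulgV act1. Qed.
Lemma res_act V (f : Hom V U) g x : res f (g • x) = res f g • res f x.
Proof. by rewrite /actg -app_res. Qed.
End ActionTheory.

Definition equivariant (C : site) (G : group_object C) (X Y : gobject G) (f : X ~> Y) :=
  forall (U : C) (g : G U) (x : X U), app f (g • x) = g • app f x.

Definition invariant (C : site) (G : group_object C) (X : gobject G) (Y : sheaf C)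
    (f : X ~> Y) : Prop :=
  forall (U : C) (g : G U) (x : X U), app f (g • x) = app f x.

Definition acts_freely (C : site) (G : group_object C) (X : gobject G) : Prop :=
  forall (U : C) (g : G U) (x : X U), g • x = x -> g = 1.

Definition left_mul (C : site) (G : group_object C) : gobject G :=
  {| gobj := G; gact := gmul G; gact1 := @mul1g C G;
     gactM := fun U g h x => eq_sym (mulgA g h x) |}.

Definition diag (C : site) (G : group_object C) (X Y : gobject G) : gobject G.
Proof.
unshelve refine {| gobj := X × Y; gact := {| app := fun U (z : (G × (X × Y)) U) =>
  (fst z • fst (snd z), fst z • snd (snd z)) : (X × Y) U |} |}.
- by move=> U V f [g [x y]] /=; rewrite !res_act.
- by move=> U [x y] /=; rewrite !act1.
- by move=> U g h [x y] /=; rewrite !actM.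
Defined.

Definition trivial_action (C : site) (G : group_object C) (Y : sheaf C) : gobject G.
Proof.
by refine {| gobj := Y; gact := pr2 G Y |}.
Defined.

(* The fiber product of X and T over Q, G acting on the first factor. *)
Definition pullback (C : site) (G : group_object C) (X : gobject G) (T Q : sheaf C)
    (q : X ~> Q) (q_inv : invariant q) (t : T ~> Q) : gobject G.
Proof.
unshelve refine {| gobj := fib_prod q t; gact := {| app := fun U (z : (G × fib_prod q t) U) =>
  exist _ (fst z • fst (proj1_sig (snd z)), snd (proj1_sig (snd z))) _
    : fib_prod q t U |} |}.
- by rewrite /= q_inv (proj2_sig (snd z)).
- by move=> U V f z; apply: sig_ext; rewrite /= res_act.
- by move=> U z; apply: sig_ext; rewrite /= act1; case: (proj1_sig z).
- by move=> U g h z; apply: sig_ext; rewrite /= actM.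
Defined.

(** ** Torsors *)

Definition trivial_torsor (C : site) (G : group_object C) (P : gobject G) : Prop :=
  exists f : left_mul G ~> P, equivariant f /\ is_iso f.

(* "Locally isomorphic to G": on a covering sieve of every object U, the
   localizations G × V and P × V are isomorphic as objects over V with G-action. *)
Definition is_torsor (C : site) (sub : subcanonical C) (G : group_object C)
    (P : gobject G) : Prop :=
  forall U : C, locally (fun V (_ : Hom V U) =>
    exists f : diag (left_mul G) (trivial_action G (yo sub V)) ~>
               diag P (trivial_action G (yo sub V)),
      equivariant f /\ is_iso f /\
      forall W (z : (G × yo sub V) W), snd (app f z) = snd z).

(** ** Quotients *)

(* q is the coequalizer of the action and the projection G × X ⇉ X in the topos. *)
Definition is_quotient (C : site) (G : group_object C) (X : gobject G) (Q : sheaf C)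
    (q : X ~> Q) : Prop :=
  invariant q /\
  forall (Z : sheaf C) (h : X ~> Z), invariant h -> exists! m : Q ~> Z, mcomp m q = h.

Section QuotientSheaf.
Variables (C : site) (G : group_object C) (X : gobject G).

Definition same_orbit (U : C) (x y : X U) : Prop :=
  locally (fun V (f : Hom V U) => exists g : G V, res f y = g • res f x).

Lemma same_orbit_act (U : C) (g : G U) (x : X U) : same_orbit x (g • x).
Proof. by apply: locally_now => V f; exists (res f g); rewrite res_act. Qed.

Lemma same_orbit_refl (U : C) (x : X U) : same_orbit x x.
Proof. by apply: locally_now => V f; exists 1; rewrite act1. Qed.

Lemma same_orbit_sym (U : C) (x y : X U) : same_orbit x y -> same_orbit y x.
Proof. by apply: locally_imp => V f [g ->]; exists g^-1; rewrite actK. Qed.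

Lemma same_orbit_trans (U : C) (x y z : X U) :
  same_orbit x y -> same_orbit y z -> same_orbit x z.
Proof.
move=> xy yz; apply: (locally_imp _ (locally_and _ xy yz)).
  by move=> V f [[g ->] [h ->]]; exists (h * g); rewrite actM.
by move=> V W f k [g E]; exists (res k g); rewrite !res_comp E res_act.
Qed.

Lemma same_orbit_res (U V : C) (f : Hom V U) (x y : X U) :
  same_orbit x y -> same_orbit (res f x) (res f y).
Proof.
move=> /(locally_pull f); apply: locally_imp => W k [g E].
by exists g; rewrite -!res_comp.
Qed.

Lemma same_orbit_local (U : C) (x y : X U) :
  locally (fun V (f : Hom V U) => same_orbit (res f x) (res f y)) -> same_orbit x y.
Proof.
move=> H; apply: (locally_bind H) => V f.
by apply: locally_imp => W k [g E]; exists g; rewrite !res_comp.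
Qed.

(* A section over U of the quotient sheaf: an orbit, as a subsheaf of the
   restriction of X to the objects over U which locally has sections. *)
Record orbit (U : C) := Orbit {
  omem : forall V, Hom V U -> X V -> Prop;
  omem_res : forall V W (f : Hom V U) (k : Hom W V) x,
    omem f x -> omem (f ∘ k) (res k x);
  omem_orbit : forall V (f : Hom V U) x y, omem f x -> (omem f y <-> same_orbit x y);
  omem_ex : locally (fun V (f : Hom V U) => exists x, omem f x);
  omem_local : forall V (f : Hom V U) x,
    locally (fun W (k : Hom W V) => omem (f ∘ k) (res k x)) -> omem f x }.

Arguments omem {U} o {V} f x.

Lemma orbit_ext (U : C) (s t : orbit U) :
  (forall V (f : Hom V U) x, omem s f x <-> omem t f x) -> s = t.
Proof.
case: s t => [s s1 s2 s3 s4] [t t1 t2 t3 t4] /= E.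
have {}E : s = t.
  apply: functional_extensionality_dep => V; apply: functional_extensionality => f.
  by apply: functional_extensionality => x; apply: propositional_extensionality.
by subst t; f_equal; apply: proof_irrelevance.
Qed.

Definition orbit_res (U V : C) (f : Hom V U) (s : orbit U) : orbit V.
Proof.
unshelve refine {| omem := fun W k x => omem s (f ∘ k) x |}.
- by move=> W T k l x; rewrite compmA; apply: omem_res.
- by move=> W k x y; apply: omem_orbit.
- exact: (locally_pull f (omem_ex s)).
- move=> W k x H; apply: omem_local.
  by apply: locally_imp H => T l; rewrite compmA.
Defined.

Definition quot_psh : presheaf C.
Proof.
refine {| sec := orbit; res := orbit_res |}.
- by move=> U s; apply: orbit_ext => V f x /=; rewrite comp1m.
- by move=> U V W f k s; apply: orbit_ext => T l x /=; rewrite compmA.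
Defined.

Lemma quot_sheaf_axiom : sheaf_axiom quot_psh.
Proof.
apply: sheaf_axiomI => [U s t H|U R cR s hs].
  apply: orbit_ext => V f x; have H' := locally_pull f H.
  by split=> sx; apply: omem_local; apply: (locally_imp _ H') => W k E;
    move/(f_equal (fun o => omem o (idm W) (res k x))): E => /=;
    rewrite compm1 => E; [rewrite -E|rewrite E]; apply: omem_res.
have hs' V W (f : Hom V U) (k : Hom W V) h h' x :
    omem (s V f h) k x <-> omem (s W (f ∘ k) h') (idm W) x.
  by rewrite -(hs V W f k h h') /= compm1.
unshelve eexists.
{ unshelve refine {| omem := fun V f x => locally (fun W (k : Hom W V) =>
    forall h : mem R (f ∘ k), omem (s W (f ∘ k) h) (idm W) (res k x)) |}.
  - move=> V W f k x /(locally_pull k); apply: locally_imp => T l.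
    by rewrite -res_comp compmA.
  - move=> V f x y sx.
    have cf : locally (fun W (k : Hom W V) => mem R (f ∘ k)).
      by exists (pull_sieve R f); split=> //; apply: covers_pull.
    have st : forall W T (k : Hom W V) (l : Hom T W), mem R (f ∘ k) -> mem R (f ∘ (k ∘ l)).
      by move=> W T k l H; rewrite compmA; apply: mem_comp.
    split=> [sy|xy].
      apply: same_orbit_local.
      have L := locally_and st cf sx.
      apply: (locally_bind L) => W k [Rk Hx].
      apply: (locally_imp _ (locally_pull k sy)) => T l Hy.
      have h' := st _ _ _ l Rk.
      apply/(@omem_orbit _ (s T (f ∘ (k ∘ l)) h') _ (idm T)); last exact: Hy.
      have h2 : mem R (f ∘ k ∘ l) by rewrite -compmA.
      have := omem_res l (Hx Rk); rewrite comp1m -res_comp => /(hs' _ _ _ _ _ h2).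
      by move: h2; rewrite -compmA => h2; rewrite (proof_irrelevance _ h2 h').
    apply: (locally_imp _ (locally_and st cf sx)) => W k [Rk Hx] h.
    by apply/(omem_orbit _ (Hx h)); apply: same_orbit_res.
  - have lR : locally (fun V (f : Hom V U) => mem R f) by exists R.
    apply: (locally_bind lR) => V f Rf.
    apply: (locally_imp _ (omem_ex (s V f Rf))) => W k [x sx]; exists x.
    apply: locally_now => T l h.
    have h' : mem R (f ∘ (k ∘ l)) by rewrite compmA.
    have := omem_res l sx => /(hs' _ _ _ _ _ h').
    by move: h'; rewrite compmA => h'; rewrite (proof_irrelevance _ h' h).
  - move=> V f x H; apply: (locally_bind H) => W k.
    by apply: locally_imp => T l; rewrite -compmA -res_comp. }
move=> V f Rf; apply: orbit_ext => W k x /=; split=> [H|sx].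
  apply: omem_local; apply: (locally_imp _ H) => T l Hl.
  have h' : mem R (f ∘ (k ∘ l)) by apply: mem_comp.
  apply/(hs' _ _ _ _ Rf h').
  by move: h'; rewrite compmA => h'; apply: Hl.
apply: locally_now => T l h.
have h' : mem R (f ∘ (k ∘ l)) by rewrite compmA.
have := omem_res l sx => /(hs' _ _ _ _ _ h').
by move: h'; rewrite compmA => h'; rewrite (proof_irrelevance _ h' h).
Qed.

Definition quot : sheaf C := Sheaf quot_sheaf_axiom.

Definition orbit_of (U : C) (x : X U) : orbit U.
Proof.
unshelve refine {| omem := fun V f y => same_orbit (res f x) y |}.
- by move=> V W f k y H; rewrite res_comp; apply: same_orbit_res.
- move=> V f y z xy; split=> [xz|yz]; last exact: same_orbit_trans yz.
  exact: same_orbit_trans (same_orbit_sym xy) xz.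
- by apply: locally_now => V f; exists (res f x); apply: same_orbit_refl.
- move=> V f y H; apply: same_orbit_local.
  by apply: locally_imp H => W k; rewrite res_comp.
Defined.

Definition quot_map : X ~> quot.
Proof.
unshelve refine {| app := fun U x => orbit_of x : quot U |}.
by move=> U V f x; apply: orbit_ext => W k y /=; rewrite res_comp.
Defined.

Lemma quot_mapP (U : C) (x y : X U) : app quot_map x = app quot_map y <-> same_orbit x y.
Proof.
split=> [/(f_equal (fun o : orbit U => omem o (idm U) y)) /=|xy].
  by rewrite !res_id => ->; apply: same_orbit_refl.
apply: orbit_ext => V f z /=; have := same_orbit_res f xy => {}xy.
split=> H; first exact: same_orbit_trans (same_orbit_sym xy) H.
exact: same_orbit_trans H.
Qed.

Lemma quot_map_surj (U : C) (b : quot U) :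
  locally (fun V (f : Hom V U) => exists x, app quot_map x = res f b).
Proof.
apply: (locally_imp _ (omem_ex b)) => V f [x bx]; exists x.
apply: orbit_ext => W k y /=; split=> H.
  exact/(omem_orbit _ (omem_res k bx)).
exact: (proj1 (omem_orbit y (omem_res k bx))).
Qed.

Lemma quot_map_inv : invariant quot_map.
Proof. by move=> U g x; apply/quot_mapP/same_orbit_sym/same_orbit_act. Qed.

Lemma same_orbit_inv (Z : sheaf C) (h : X ~> Z) (U : C) (x y : X U) :
  invariant h -> same_orbit x y -> app h x = app h y.
Proof.
move=> hi xy; apply: sheaf_sep; apply: (locally_imp _ xy) => V f [g E].
by rewrite -!app_res E hi.
Qed.

Theorem quot_is_quotient : is_quotient quot_map.
Proof.
split=> [|Z h hi]; first exact: quot_map_inv.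
have E : forall U (a a' : X U), app quot_map a = app quot_map a' -> app h a = app h a'.
  by move=> U a a' /quot_mapP; apply: same_orbit_inv.
exists (descend quot_map_surj E); split; first by apply: mor_ext => U x; apply: descendE.
move=> m Em; apply: mor_ext => U b; apply: sheaf_sep.
apply: (locally_imp _ (quot_map_surj b)) => V f [x Ex].
by rewrite -!app_res -Ex descendE -Em.
Qed.

Section Quotient.
Variables (Q : sheaf C) (q : X ~> Q) (hq : is_quotient q).

Lemma quotient_orbit (U : C) (x y : X U) : app q x = app q y -> same_orbit x y.
Proof.
have [m [Em _]] := proj2 hq _ _ quot_map_inv.
by move=> E; apply/quot_mapP; rewrite -Em /= E.
Qed.

Lemma quotient_surj (U : C) (b : Q U) :
  locally (fun V (f : Hom V U) => exists x, app q x = res f b).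
Proof.
have [m [Em _]] := proj2 hq _ _ quot_map_inv.
have [n [En _]] := proj2 quot_is_quotient _ _ (proj1 hq).
have [i [_ ui]] := proj2 hq _ _ (proj1 hq).
have Em' V (x : X V) : app m (app q x) = app quot_map x by rewrite -Em.
have En' V (x : X V) : app n (app quot_map x) = app q x by rewrite -En.
have nm : mcomp n m = mid Q.
  transitivity i; [symmetry|]; apply: ui; apply: mor_ext => V x //=.
  by rewrite Em' En'.
apply: (locally_imp _ (quot_map_surj (app m b))) => V f [x Ex]; exists x.
by rewrite -[RHS]/(app (mid Q) (res f b)) -nm /= app_res -Ex En'.
Qed.

Lemma quotient_free (U : C) (x y : X U) :
  acts_freely X -> app q x = app q y -> exists! g : G U, y = g • x.
Proof.
move=> fr E.
have fr' V (g h : G V) (z : X V) : g • z = h • z -> g = h.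
  move=> Egh; have H := fr V (h^-1 * g) z.
  by apply: (@mulgI _ _ _ h^-1); rewrite mulVg; apply: H; rewrite actM Egh actK.
have [|||z [hz _]] := @sheaf_glue C G U (fun V f g => res f y = g • res f x).
- by move=> V W f k g H; rewrite !res_comp H res_act.
- by move=> V f g h H; rewrite H => /fr'.
- exact: quotient_orbit.
- have Ez : y = z • x.
  apply: sheaf_sep; apply: (locally_imp _ (quotient_orbit E)) => V f [g Eg].
  by rewrite Eg res_act (hz V f g Eg).
by exists z; split=> // z'; rewrite Ez => /fr'.
Qed.
End Quotient.

End QuotientSheaf.

Arguments quot {C G} X.
Arguments quot_map {C G} X.

(** * Twisted forms *)

Section TorsorTheory.
Variables (C : site) (sub : subcanonical C) (G : group_object C) (P : gobject G).
Hypothesis P_torsor : is_torsor sub P.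

Lemma torsor_ex (U : C) : locally (fun V (_ : Hom V U) => exists p : P V, True).
Proof.
apply: (locally_imp _ (P_torsor U)) => V _ [f _].
by exists (fst (app f ((1, idm V) : (G × yo sub V) V))).
Qed.

Lemma torsor_free : acts_freely P.
Proof.
move=> U g p E; apply: sheaf_sep.
apply: (locally_imp _ (P_torsor U)) => V k [f [fe [fi fo]]].
have [[a l] Ea] := is_iso_surj fi ((res k p, idm V) : (P × yo sub V) V).
have := fe V (res k g) (a, l); rewrite Ea => H.
have /(is_iso_inj fi) [Eg] : app f (res k g • ((a, l) : diag (left_mul G) _ V)) = app f (a, l).
  by rewrite H Ea /actg /= -/(actg _ _) -res_act E.
have {}Eg : res k g * a = a by [].
by rewrite res_oneg -(mulgK (res k g) a) Eg mulgV.
Qed.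

Lemma torsor_inj (U : C) (g h : G U) (p : P U) : g • p = h • p -> g = h.
Proof.
move=> E; apply: (@mulgI _ _ _ h^-1); rewrite mulVg; apply: (@torsor_free _ _ p).
by rewrite actM E actK.
Qed.

Lemma torsor_trans (U : C) (p p' : P U) : exists g : G U, p' = g • p.
Proof.
have L : locally (fun V (f : Hom V U) => exists g : G V, res f p' = g • res f p).
  apply: (locally_imp _ (P_torsor U)) => V k [f [fe [fi fo]]].
  have [[a l] Ea] := is_iso_surj fi ((res k p, idm V) : (P × yo sub V) V).
  have [[a' l'] Ea'] := is_iso_surj fi ((res k p', idm V) : (P × yo sub V) V).
  have El := fo V (a, l); have El' := fo V (a', l').
  rewrite Ea /= in El; rewrite Ea' /= in El'; subst l l'.
  exists (a' * a^-1); have := fe V (a' * a^-1) (a, idm V).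
  rewrite Ea => H.
  have {}H : app f ((a' * a^-1 * a, idm V) : (G × yo sub V) V)
    = ((a' * a^-1) • res k p, idm V) := H.
  by move: H; rewrite mulgVK Ea' => -[].
have [|||z [hz _]] := @sheaf_glue C G U (fun V f g => res f p' = g • res f p).
- by move=> V W f k g H; rewrite !res_comp H res_act.
- by move=> V f g h H; rewrite H => /torsor_inj.
- exact: L.
- exists z; apply: sheaf_sep; apply: (locally_imp _ L) => V f [g Eg].
by rewrite Eg res_act (hz V f g Eg).
Qed.

End TorsorTheory.

Record ggroup (C : site) (G : group_object C) := GGroup {
  ggrp :> group_object C;
  ggact : G × ggrp ~> ggrp;
  ggact1 : forall (U : C) (x : ggrp U), app ggact (1 : G U, x) = x;
  ggactM : forall (U : C) (g h : G U) (x : ggrp U),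
    app ggact (g * h, x) = app ggact (g, app ggact (h, x));
  ggact_aut : forall (U : C) (g : G U) (x y : ggrp U),
    app ggact (g, x * y) = app ggact (g, x) * app ggact (g, y) }.

Definition ggobj (C : site) (G : group_object C) (Z : ggroup G) : gobject G :=
  {| gobj := Z; gact := ggact Z; gact1 := @ggact1 C G Z; gactM := @ggactM C G Z |}.

Definition conj_ggroup (C : site) (G : group_object C) : ggroup G.
Proof.
unshelve refine {| ggrp := G; ggact := {| app := fun U (z : (G × G) U) =>
  fst z * snd z * (fst z)^-1 : G U |} |}.
- by move=> U V f z; rewrite /= !res_mulg res_invg.
- by move=> U x; rewrite /= inv1g mulg1 mul1g.
- by move=> U g h x; rewrite /= invMg !mulgA.
- by move=> U g x y; rewrite /= !mulgA mulgVK.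
Defined.

(* The twisted form P ∧^G Z = G \ (P × Z) and the class p ∧ z. *)
Definition twist (C : site) (G : group_object C) (P Z : gobject G) : sheaf C :=
  quot (diag P Z).
Arguments twist : simpl never.

Definition wedge (C : site) (G : group_object C) (P Z : gobject G) (U : C)
    (p : P U) (z : Z U) : twist P Z U :=
  app (quot_map (diag P Z)) (p, z).

Lemma res_wedge (C : site) (G : group_object C) (P Z : gobject G) (U V : C)
    (f : Hom V U) (p : P U) (z : Z U) :
  res f (wedge p z) = wedge (res f p) (res f z).
Proof. by rewrite /wedge -app_res. Qed.

Lemma wedge_act (C : site) (G : group_object C) (P Z : gobject G) (U : C)
    (g : G U) (p : P U) (z : Z U) : wedge (g • p) (g • z) = wedge p z.
Proof. exact: (@quot_map_inv _ _ (diag P Z) U g (p, z)). Qed.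

Section TwistTheory.
Variables (C : site) (sub : subcanonical C) (G : group_object C) (P : gobject G).
Hypothesis P_torsor : is_torsor sub P.
Variable Z : gobject G.

Lemma wedge_inj (U : C) (p : P U) (z z' : Z U) : wedge p z = wedge p z' -> z = z'.
Proof.
move=> /quot_mapP H; apply: sheaf_sep; apply: (locally_imp _ H) => V f [g E].
case: E => E1 E2.
have g1 : g = 1 by apply: (torsor_free P_torsor); symmetry; exact: E1.
have {}E2 : res f z' = g • res f z by [].
by rewrite E2 g1 act1.
Qed.

Lemma wedge_at (U : C) (t : twist P Z U) (p : P U) :
  locally (fun V (f : Hom V U) => exists z, res f t = wedge (res f p) z).
Proof.
apply: (locally_imp _ (quot_map_surj t)) => V f [[p' z'] E].
have [g Eg] := torsor_trans P_torsor p' (res f p).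
by exists (g • z'); rewrite Eg wedge_act -E.
Qed.

Lemma wedge_at3 (U : C) (t1 t2 t3 : twist P Z U) (p : P U) :
  locally (fun V (f : Hom V U) => exists z1 z2 z3,
    res f t1 = wedge (res f p) z1 /\ res f t2 = wedge (res f p) z2 /\
    res f t3 = wedge (res f p) z3).
Proof.
apply: (locally_bind (wedge_at t1 p)) => V f [z1 E1].
apply: (locally_bind (wedge_at (res f t2) (res f p))) => W k [z2 E2].
apply: (locally_imp _ (wedge_at (res k (res f t3)) (res k (res f p)))) => T l [z3 E3].
exists (res l (res k z1)), (res l z2), z3.
by rewrite !res_comp E1 !res_wedge E2 E3 res_wedge.
Qed.

Lemma wedge_ex3 (U : C) (t1 t2 t3 : twist P Z U) :
  locally (fun V (f : Hom V U) => exists p z1 z2 z3,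
    res f t1 = wedge p z1 /\ res f t2 = wedge p z2 /\ res f t3 = wedge p z3).
Proof.
apply: (locally_bind (torsor_ex P_torsor U)) => V f [p _].
apply: (locally_imp _ (wedge_at3 (res f t1) (res f t2) (res f t3) p)).
move=> W k [z1 [z2 [z3 H]]]; exists (res k p), z1, z2, z3.
by rewrite !res_comp.
Qed.

End TwistTheory.

Section TwistedGroup.
Variables (C : site) (sub : subcanonical C) (G : group_object C) (P : gobject G).
Hypothesis P_torsor : is_torsor sub P.
Variable Z : ggroup G.

Notation PZ := (twist P (ggobj Z)).

Lemma ggactX (U : C) (g : G U) (x y : ggobj Z U) :
  g • ((x : Z U) * y : ggobj Z U) = ((g • x : Z U) * (g • y : Z U) : ggobj Z U).
Proof. exact: ggact_aut. Qed.

Lemma ggactI (U : C) (g : G U) : g • (1 : ggobj Z U) = (1 : Z U).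
Proof.
by apply: (@mulgI _ _ _ (g • (1 : ggobj Z U) : Z U)); rewrite -ggactX !mulg1.
Qed.

Lemma ggactV (U : C) (g : G U) (x : ggobj Z U) :
  g • ((x : Z U)^-1 : ggobj Z U) = ((g • x : Z U)^-1 : Z U).
Proof. by apply: (@mulgI _ _ _ (g • x : Z U)); rewrite -ggactX !mulgV ggactI. Qed.

Definition pair_wedge : P × (Z × Z) ~> PZ × PZ.
Proof.
unshelve refine {| app := fun U (a : (P × (Z × Z)) U) =>
  (wedge (Z := ggobj Z) (fst a) (fst (snd a)), wedge (Z := ggobj Z) (fst a) (snd (snd a)))
  : (PZ × PZ) U |}.
by move=> U V f [p [x y]]; rewrite /= -!res_wedge.
Defined.

Definition mul_wedge : P × (Z × Z) ~> PZ.
Proof.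
unshelve refine {| app := fun U (a : (P × (Z × Z)) U) =>
  wedge (Z := ggobj Z) (fst a) (fst (snd a) * snd (snd a)) |}.
by move=> U V f a; cbv beta; rewrite res_wedge [in RHS]res_mulg.
Defined.

Definition one_wedge : P ~> PZ.
Proof.
unshelve refine {| app := fun U p => wedge (Z := ggobj Z) p (1 : Z U) |}.
by move=> U V f p; cbv beta; rewrite res_wedge res_oneg.
Defined.

Definition inv_wedge : P × Z ~> PZ.
Proof.
unshelve refine {| app := fun U (a : (P × Z) U) =>
  wedge (Z := ggobj Z) (fst a) (snd a)^-1 |}.
by move=> U V f a; cbv beta; rewrite res_wedge [in RHS]res_invg.
Defined.

Definition to_unit : P ~> unit_sheaf C.
Proof. by unshelve refine {| app := fun U _ => tt : unit_sheaf C U |}. Defined.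

Lemma pair_wedge_surj (U : C) (b : (PZ × PZ) U) :
  locally (fun V (f : Hom V U) => exists a, app pair_wedge a = res f b).
Proof.
case: b => t1 t2; apply: (locally_imp _ (wedge_ex3 P_torsor t1 t2 t2)).
by move=> V f [p [z1 [z2 [_ [E1 [E2 _]]]]]]; exists (p, (z1, z2)); rewrite -[RHS]/(res f t1, res f t2) E1 E2.
Qed.

Lemma wedge_eq (U : C) (p p' : P U) (x x' : ggobj Z U) :
  wedge p x = wedge p' x' -> exists g, p' = g • p /\ x' = g • x.
Proof.
have [g ->] := torsor_trans P_torsor p p'; rewrite -(wedge_act g p x).
by move/(wedge_inj P_torsor) => <-; exists g.
Qed.

Lemma mul_wedge_wd (U : C) (a a' : (P × (Z × Z)) U) :
  app pair_wedge a = app pair_wedge a' -> app mul_wedge a = app mul_wedge a'.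
Proof.
case: a a' => [p [x y]] [p' [x' y']] E.
have /wedge_eq [g [Eg E1]] :
  wedge (Z := ggobj Z) p x = wedge (Z := ggobj Z) p' x' := f_equal fst E.
have /wedge_eq [h [Eh E2]] :
  wedge (Z := ggobj Z) p y = wedge (Z := ggobj Z) p' y' := f_equal snd E.
subst p'; have ? := torsor_inj P_torsor Eh; subst h.
rewrite /= E1 E2 -[RHS]/(wedge (g • p) _) -ggactX; symmetry; exact: wedge_act.
Qed.

Lemma one_wedge_wd (U : C) (p p' : P U) :
  app to_unit p = app to_unit p' -> app one_wedge p = app one_wedge p'.
Proof.
move=> _; have [g ->] := torsor_trans P_torsor p p'.
by rewrite /= -[in RHS](ggactI g) wedge_act.
Qed.

Lemma inv_wedge_wd (U : C) (a a' : (P × Z) U) :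
  app (quot_map (diag P (ggobj Z))) a = app (quot_map (diag P (ggobj Z))) a' ->
  app inv_wedge a = app inv_wedge a'.
Proof.
case: a a' => [p x] [p' x'] E.
have {E} /wedge_eq [g [-> ->]] :
  wedge (Z := ggobj Z) p x = wedge (Z := ggobj Z) p' x' := E.
by rewrite /= -ggactV wedge_act.
Qed.

Lemma to_unit_surj (U : C) (b : unit_sheaf C U) :
  locally (fun V (f : Hom V U) => exists a, app to_unit a = res f b).
Proof.
by apply: (locally_imp _ (torsor_ex P_torsor U)) => V f [p _]; exists p; case: b.
Qed.

Definition twist_mul : PZ × PZ ~> PZ := descend pair_wedge_surj mul_wedge_wd.
Definition twist_one : unit_sheaf C ~> PZ := descend to_unit_surj one_wedge_wd.
Definition twist_inv : PZ ~> PZ :=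
  descend (@quot_map_surj C G (diag P (ggobj Z))) inv_wedge_wd.

Lemma twist_mulE (U : C) (p : P U) (x y : Z U) :
  app twist_mul (wedge (Z := ggobj Z) p x, wedge (Z := ggobj Z) p y)
  = wedge (Z := ggobj Z) p (x * y).
Proof. exact: (descendE pair_wedge_surj mul_wedge_wd (p, (x, y))). Qed.

Lemma twist_oneE (U : C) (p : P U) :
  app twist_one (tt : unit_sheaf C U) = wedge (Z := ggobj Z) p (1 : Z U).
Proof. exact: (descendE to_unit_surj one_wedge_wd p). Qed.

Lemma twist_invE (U : C) (p : P U) (x : Z U) :
  app twist_inv (wedge (Z := ggobj Z) p x) = wedge (Z := ggobj Z) p x^-1.
Proof.
exact: (descendE (@quot_map_surj C G (diag P (ggobj Z))) inv_wedge_wd (p, x)).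
Qed.

Lemma res_tm (U V : C) (f : Hom V U) (t t' : PZ U) :
  res f (app twist_mul (t, t')) = app twist_mul (res f t, res f t').
Proof. by rewrite -app_res. Qed.

Lemma res_t1 (U V : C) (f : Hom V U) :
  res f (app twist_one (tt : unit_sheaf C U)) = app twist_one (tt : unit_sheaf C V).
Proof. by rewrite -app_res. Qed.

(* The group structure on P ∧^G Z: (p ∧ x)(p ∧ y) = p ∧ xy. *)
Definition twisted_group : group_object C.
Proof.
unshelve refine {| gcar := PZ; gmul := twist_mul; gone := twist_one; ginv := twist_inv |}.
- move=> U x y z; apply: sheaf_sep.
  apply: (locally_imp _ (wedge_ex3 P_torsor x y z)) => V f [p [a [b [c [Ea [Eb Ec]]]]]].
  by rewrite !res_tm Ea Eb Ec !twist_mulE mulgA.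
- move=> U x; apply: sheaf_sep.
  apply: (locally_imp _ (wedge_ex3 P_torsor x x x)) => V f [p [a [_ [_ [Ea _]]]]].
  by rewrite !res_tm res_t1 Ea (twist_oneE p) !twist_mulE mul1g.
- move=> U x; apply: sheaf_sep.
  apply: (locally_imp _ (wedge_ex3 P_torsor x x x)) => V f [p [a [_ [_ [Ea _]]]]].
  by rewrite !res_tm res_t1 Ea (twist_oneE p) !twist_mulE mulg1.
- move=> U x; apply: sheaf_sep.
  apply: (locally_imp _ (wedge_ex3 P_torsor x x x)) => V f [p [a [_ [_ [Ea _]]]]].
  by rewrite !res_tm res_t1 -app_res Ea (twist_oneE p) twist_invE !twist_mulE mulVg.
- move=> U x; apply: sheaf_sep.
  apply: (locally_imp _ (wedge_ex3 P_torsor x x x)) => V f [p [a [_ [_ [Ea _]]]]].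
  by rewrite !res_tm res_t1 -app_res Ea (twist_oneE p) twist_invE !twist_mulE mulgV.
Defined.

End TwistedGroup.

(** ** Automorphisms of a torsor *)

Section TorsorAut.
Variables (C : site) (sub : subcanonical C) (H : group_object C) (P : gobject H).
Hypothesis P_torsor : is_torsor sub P.

Notation cH := (conj_ggroup H).
Notation PH := (twisted_group P_torsor cH).

Definition wedge_pair : P × H ~> PH × P.
Proof.
unshelve refine {| app := fun U (a : (P × H) U) =>
  (wedge (Z := ggobj cH) (fst a) (snd a), fst a) : (PH × P) U |}.
by move=> U V f [p h]; rewrite /= -res_wedge.
Defined.

Definition swap_act : P × H ~> P.
Proof.
unshelve refine {| app := fun U (a : (P × H) U) => snd a • fst a |}.
by move=> U V f [p h]; rewrite /= -res_act.
Defined.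

Lemma wedge_pair_surj (U : C) (b : (PH × P) U) :
  locally (fun V (f : Hom V U) => exists a, app wedge_pair a = res f b).
Proof.
case: b => t p; apply: (locally_imp _ (wedge_at P_torsor (t : twist P (ggobj cH) U) p)).
by move=> V f [h E]; exists (res f p, h); rewrite /= -E.
Qed.

Lemma swap_act_wd (U : C) (a a' : (P × H) U) :
  app wedge_pair a = app wedge_pair a' -> app swap_act a = app swap_act a'.
Proof.
case: a a' => [p h] [p' h'] E.
have Ep : p = p' := f_equal snd E; subst p'.
have Eh : wedge (Z := ggobj cH) p h = wedge (Z := ggobj cH) p h' := f_equal fst E.
by rewrite (wedge_inj P_torsor Eh).
Qed.

(* The automorphism of P given by p ∧ h is the H-equivariant map with p ↦ hp.  Composition
   reverses products, whence Aut(P) is the opposite group of PH. *)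
Definition torsor_aut : PH × P ~> P := descend wedge_pair_surj swap_act_wd.

Definition taut (U : C) (t : PH U) (p : P U) : P U := app torsor_aut (t, p).

Lemma tautE (U : C) (p : P U) (h : H U) :
  taut (wedge (Z := ggobj cH) p h) p = h • p.
Proof. exact: (descendE wedge_pair_surj swap_act_wd (p, h)). Qed.

Lemma res_taut (U V : C) (f : Hom V U) (t : PH U) (p : P U) :
  res f (taut t p) = taut (res f t) (res f p).
Proof. by rewrite /taut -app_res. Qed.

Lemma taut_act (U : C) (t : PH U) (h : H U) (p : P U) : taut t (h • p) = h • taut t p.
Proof.
apply: sheaf_sep.
apply: (locally_imp _ (wedge_at P_torsor (t : twist P (ggobj cH) U) p)) => V f [z E].
have {}E : res f (t : PH U) = wedge (Z := ggobj cH) (res f p) z by [].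
rewrite res_taut !res_act res_taut E tautE -(wedge_act (res f h)) tautE.
rewrite -!actM; congr (_ • _).
by rewrite /actg /= -/(mulg _ _) mulgVK.
Qed.

Lemma taut1 (U : C) (p : P U) : taut 1 p = p.
Proof.
have -> : (1 : PH U) = wedge (Z := ggobj cH) p (1 : H U) := twist_oneE P_torsor cH p.
by rewrite tautE act1.
Qed.

Lemma tautM (U : C) (t t' : PH U) (p : P U) : taut (t * t') p = taut t' (taut t p).
Proof.
apply: sheaf_sep.
apply: (locally_imp _ (wedge_at3 P_torsor (Z := ggobj cH) t t' t' p)).
move=> V f [z [z' [_ [E [E' _]]]]].
have {}E : res f (t : PH U) = wedge (Z := ggobj cH) (res f p) z by [].
have {}E' : res f (t' : PH U) = wedge (Z := ggobj cH) (res f p) z' by [].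
have M : res f (t * t') = wedge (Z := ggobj cH) (res f p) ((z : H V) * z').
  by rewrite res_mulg E E'; exact: (twist_mulE P_torsor (Z := cH) (res f p) z z').
by rewrite !res_taut M E E' !tautE taut_act tautE actM.
Qed.

End TorsorAut.

(** * The object of equivariant isomorphisms *)

Section Isom.
Variables (C : site) (sub : subcanonical C) (G : group_object C) (A A' : gobject G)
  (B : sheaf C) (a : A ~> B) (a' : A' ~> B).
Hypotheses (a_inv : invariant a) (a'_inv : invariant a').

(* A section over U of Isom(A, A') over B: a point y of B over U and a
   G-equivariant isomorphism A ×_B U ~> A' ×_B U over U.  An action of the group
   object G × B over B on A is an action of G on A leaving A ~> B invariant, so
   that equivariance for G × B means equivariance for G. *)
Record isom (U : C) := IsomSec {
  ibase : B U;
  imap : pullback a_inv (yo_point sub ibase) ~> pullback a'_inv (yo_point sub ibase);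
  imap_over : mcomp (fib_pr2 a' (yo_point sub ibase)) imap
              = fib_pr2 a (yo_point sub ibase);
  imap_equiv : equivariant imap;
  imap_iso : is_iso imap }.

Definition ieval (U : C) (s : isom U) V (f : Hom V U) (x : A V)
    (e : app a x = res f (ibase s)) : A' V :=
  fst (proj1_sig (app (imap s) (exist _ (x, f) e : fib_prod a (yo_point sub (ibase s)) V))).

Arguments ieval {U} s {V} f x e.

Lemma ievalE (U : C) (s : isom U) V (f : Hom V U) (x : A V) e :
  proj1_sig (app (imap s) (exist _ (x, f) e : fib_prod a (yo_point sub (ibase s)) V))
  = (ieval s f x e, f).
Proof.
rewrite /ieval; set z := app _ _.
have : snd (proj1_sig z) = f.
  exact: (f_equal (fun m => app m (exist _ (x, f) e : fib_prod a (yo_point sub (ibase s)) V))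
                  (imap_over s)).
by case: (proj1_sig z) => ? ? /= ->.
Qed.

Lemma ieval_over (U : C) (s : isom U) V (f : Hom V U) (x : A V) e :
  app a' (ieval s f x e) = res f (ibase s).
Proof.
have H := proj2_sig (app (imap s) (exist _ (x, f) e : fib_prod a (yo_point sub (ibase s)) V)).
by move: H; cbv beta; rewrite ievalE.
Qed.

Lemma ieval_res (U : C) (s : isom U) V W (f : Hom V U) (k : Hom W V) (x : A V) e e' :
  res k (ieval s f x e) = ieval s (f ∘ k) (res k x) e'.
Proof.
pose z := exist _ (x, f) e : fib_prod a (yo_point sub (ibase s)) V.
have E : res k z = (exist _ (res k x, f ∘ k) e' : fib_prod a (yo_point sub (ibase s)) W).
  exact: sig_ext.
by rewrite /ieval -E app_res.
Qed.

Lemma ieval_act (U : C) (s : isom U) V (f : Hom V U) (g : G V) (x : A V) e e' :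
  ieval s f (g • x) e' = g • ieval s f x e.
Proof.
pose z := exist _ (x, f) e : pullback a_inv (yo_point sub (ibase s)) V.
have E : g • z = (exist _ (g • x, f) e' : pullback a_inv (yo_point sub (ibase s)) V).
  exact: sig_ext.
by rewrite /ieval -[exist _ (g • x, f) e']E imap_equiv.
Qed.

Lemma ieval_irr (U : C) (s : isom U) V (f : Hom V U) (x x' : A V) e e' :
  x = x' -> ieval s f x e = ieval s f x' e'.
Proof. by move=> E; subst x'; rewrite (proof_irrelevance _ e e'). Qed.

Lemma ieval_inj (U : C) (s : isom U) V (f : Hom V U) (x x' : A V) e e' :
  ieval s f x e = ieval s f x' e' -> x = x'.
Proof.
move=> E.
have /(is_iso_inj (imap_iso s)) [//] :
  app (imap s) (exist _ (x, f) e : fib_prod a (yo_point sub (ibase s)) V)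
  = app (imap s) (exist _ (x', f) e' : fib_prod a (yo_point sub (ibase s)) V).
by apply: sig_ext; rewrite !ievalE E.
Qed.

Lemma ieval_surj (U : C) (s : isom U) V (f : Hom V U) (y : A' V) :
  app a' y = res f (ibase s) -> exists x e, ieval s f x e = y.
Proof.
move=> e.
have [[[x l] e'] E] := is_iso_surj (imap_iso s)
  (exist _ (y, f) e : fib_prod a' (yo_point sub (ibase s)) V).
have := ievalE e'; rewrite E /= => -[E1 E2].
by subst l; exists x, e'.
Qed.

Lemma isom_ext (U : C) (s t : isom U) : ibase s = ibase t ->
  (forall V (f : Hom V U) x e e', ieval s f x e = ieval t f x e') -> s = t.
Proof.
move=> Eb Em.
case: s t Eb Em => [y m mo me mi] [y' m' mo' me' mi'] /= Eb; subst y' => Em.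
have E : m = m'.
  apply: mor_ext => V [[x f] e]; apply: sig_ext.
  have H := ievalE (s := IsomSec mo me mi) (f := f) (x := x) e.
  have H' := ievalE (s := IsomSec mo' me' mi') (f := f) (x := x) e.
  by rewrite [LHS]H [RHS]H' (Em V f x e e).
by subst m'; f_equal; apply: proof_irrelevance.
Qed.

Section MkIsom.
Variables (U : C) (y : B U)
  (F : forall V (f : Hom V U) (x : A V), app a x = res f y -> A' V).
Arguments F {V} f x _.
Hypotheses
  (F_over : forall V (f : Hom V U) x e, app a' (F f x e) = res f y)
  (F_res : forall V W (f : Hom V U) (k : Hom W V) x e e',
     res k (F f x e) = F (f ∘ k) (res k x) e')
  (F_act : forall V (f : Hom V U) (g : G V) x e e', F f (g • x) e' = g • F f x e)
  (F_inj : forall V (f : Hom V U) x x' e e', F f x e = F f x' e' -> x = x')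
  (F_surj : forall V (f : Hom V U) z, app a' z = res f y -> exists x e, F f x e = z).

Definition mk_imap : pullback a_inv (yo_point sub y) ~> pullback a'_inv (yo_point sub y).
Proof.
unshelve refine {| app := fun V (z : fib_prod a (yo_point sub y) V) =>
  exist _ (F (snd (proj1_sig z)) (fst (proj1_sig z)) (proj2_sig z), snd (proj1_sig z))
        (F_over (proj2_sig z)) : fib_prod a' (yo_point sub y) V |}.
move=> V W k [[x f] e]; apply: sig_ext; congr pair.
by symmetry; apply: F_res.
Defined.

Definition mk_isom : isom U.
Proof.
refine (@IsomSec U y mk_imap _ _ _).
- exact: mor_ext.
- by move=> V g [[x f] e]; apply: sig_ext; congr pair; apply: F_act.
- apply: bij_is_iso => V.
    move=> [[x f] e] [[x' f'] e'] /(f_equal (@proj1_sig _ _)) /= [E1 E2].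
    by subst f'; apply: sig_ext; congr pair; apply: F_inj E1.
  move=> [[z f] e]; have [x [e' E]] := F_surj e.
  exists (exist _ (x, f) e'); apply: sig_ext; congr pair; exact: E.
Defined.

Lemma mk_isomE V (f : Hom V U) x e : ieval mk_isom f x e = F f x e.
Proof. by []. Qed.
End MkIsom.

Lemma res_eq (F : presheaf C) (U V W : C) (f : Hom V U) (k : Hom W V) (x : F W) (y : F U) :
  x = res k (res f y) -> x = res (f ∘ k) y.
Proof. by move=> ->; rewrite res_comp. Qed.

Lemma res_eq' (F : presheaf C) (U V W : C) (f : Hom V U) (k : Hom W V) (x : F V) (y : F U) :
  x = res f y -> res k x = res (f ∘ k) y.
Proof. by move=> ->; rewrite res_comp. Qed.

Lemma eq_res_id (F : presheaf C) (U : C) (x y : F U) : x = y -> x = res (idm U) y.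
Proof. by rewrite res_id. Qed.

Definition isom_res (U V : C) (f : Hom V U) (s : isom U) : isom V.
Proof.
unshelve refine (@mk_isom V (res f (ibase s))
  (fun W k x e => ieval s (f ∘ k) x (res_eq e)) _ _ _ _ _).
- by move=> W k x e; rewrite ieval_over res_comp.
- move=> W T k l x e e'.
  have e2 : app a (res l x) = res (f ∘ k ∘ l) (ibase s).
    by rewrite app_res e !res_comp.
  rewrite (ieval_res (s := s) _ e2); move: e2 (res_eq e').
  by rewrite compmA => e2 e3; apply: ieval_irr.
- by move=> W k g x e e'; apply: ieval_act.
- by move=> W k x x' e e'; apply: ieval_inj.
- move=> W k z /res_eq /ieval_surj [x [e E]].
  have e' : app a x = res k (res f (ibase s)) by rewrite e res_comp.
  by exists x, e'; rewrite -E; apply: ieval_irr.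
Defined.

Lemma isom_resE (U V W : C) (f : Hom V U) (k : Hom W V) (s : isom U) x e e' :
  ieval (isom_res f s) k x e = ieval s (f ∘ k) x e'.
Proof. by rewrite -[LHS]/(ieval s (f ∘ k) x (res_eq e)); apply: ieval_irr. Qed.

Lemma ieval_hom (U : C) (s : isom U) V (f f' : Hom V U) x e e' :
  f = f' -> ieval s f x e = ieval s f' x e'.
Proof. by move=> E; subst f'; apply: ieval_irr. Qed.

Lemma ieval_eq (U : C) (s t : isom U) V (f : Hom V U) x e e' :
  s = t -> ieval s f x e = ieval t f x e'.
Proof. by move=> E; subst t; apply: ieval_irr. Qed.

Definition isom_psh : presheaf C.
Proof.
refine {| sec := isom; res := isom_res |}.
- move=> U s; apply: isom_ext => [|V f x e e']; first exact: res_id.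
  have e2 : app a x = res (idm U ∘ f) (ibase s) by rewrite comp1m.
  by rewrite (isom_resE _ e2); apply: ieval_hom; rewrite comp1m.
- move=> U V W f k s; apply: isom_ext => [|T l x e e']; first exact: res_comp.
  have e1 : app a x = res (f ∘ k ∘ l) (ibase s) by rewrite e /= !res_comp.
  have e2 : app a x = res (k ∘ l) (ibase (isom_res f s)) by rewrite e /= !res_comp.
  have e3 : app a x = res (f ∘ (k ∘ l)) (ibase s) by rewrite e /= !res_comp.
  rewrite (isom_resE _ e1) (isom_resE _ e2) (isom_resE _ e3).
  by apply: ieval_hom; rewrite compmA.
Defined.

Lemma isom_sheaf_axiom : sheaf_axiom isom_psh.
Proof.
apply: sheaf_axiomI => [U s t E|U R cR s hs].
  have Eb : ibase s = ibase t.
    by apply: sheaf_sep; apply: (locally_imp _ E) => V f /(f_equal (@ibase V)).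
  apply: isom_ext => // V f x e e'; apply: sheaf_sep.
  apply: (locally_imp _ (locally_pull f E)) => W k H.
  have e1 : app a (res k x) = res (f ∘ k) (ibase s) by rewrite app_res e res_comp.
  have e2 : app a (res k x) = res (f ∘ k) (ibase t) by rewrite e1 Eb.
  rewrite (ieval_res e e1) (ieval_res e' e2).
  have e3 : app a (res k x) = res (idm W) (ibase (isom_res (f ∘ k) s)) by rewrite res_id e1.
  have e4 : app a (res k x) = res (idm W) (ibase (isom_res (f ∘ k) t)) by rewrite res_id e2.
  have e5 : app a (res k x) = res (f ∘ k ∘ idm W) (ibase s) by rewrite compm1.
  have e6 : app a (res k x) = res (f ∘ k ∘ idm W) (ibase t) by rewrite compm1.
  rewrite -(@ieval_hom _ s _ (f ∘ k ∘ idm W) _ _ e5 e1); first by rewrite compm1.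
  rewrite -(@ieval_hom _ t _ (f ∘ k ∘ idm W) _ _ e6 e2); first by rewrite compm1.
  by rewrite -(isom_resE e3 e5) -(isom_resE e4 e6); apply: ieval_eq.
have [|y hy] := @glue_fun C B U R cR (fun V f h => ibase (s V f h : isom V)).
  by move=> V W f k h h'; rewrite -(hs V W f k h h').
have cf V (f : Hom V U) : locally (fun W (k : Hom W V) => mem R (f ∘ k)).
  by exists (pull_sieve R f); split=> //; apply: covers_pull.
have sb V (f : Hom V U) h : ibase (s V f h : isom V) = res f y by rewrite hy.
have comp V W (f : Hom V U) (k : Hom W V) h h' x e e' :
    ieval (s V f h : isom V) k x e = ieval (s W (f ∘ k) h' : isom W) (idm W) x e'.
  have e2 : app a x = res (idm W) (ibase (isom_res k (s V f h))).
    by rewrite res_id e.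
  have e3 : app a x = res (k ∘ idm W) (ibase (s V f h : isom V)) by rewrite compm1.
  rewrite -(@ieval_eq _ _ _ _ (idm W) x e2 e' (hs V W f k h h')) (isom_resE _ e3).
  by apply: ieval_hom; rewrite compm1.
have exE V (f : Hom V U) (x : A V) (h : mem R f) : app a x = res f y ->
    app a x = res (idm V) (ibase (s V f h : isom V)).
  by rewrite res_id sb.
have gl V (f : Hom V U) (x : A V) : app a x = res f y ->
    exists! z : A' V, forall W (k : Hom W V) (h : mem R (f ∘ k)) e,
      res k z = ieval (s W (f ∘ k) h : isom W) (idm W) (res k x) e.
{ move=> ex.
  have [|||z [hz uz]] := @sheaf_glue C A' V (fun W k z => exists (h : mem R (f ∘ k)) e,
      z = ieval (s W (f ∘ k) h : isom W) (idm W) (res k x) e).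
  - move=> W T k l _ [h [e ->]].
    have h1 : mem R (f ∘ k ∘ l) by apply: mem_comp.
    have h' : mem R (f ∘ (k ∘ l)) by rewrite compmA.
    have ex' : app a (res (k ∘ l) x) = res (f ∘ (k ∘ l)) y.
      by rewrite app_res ex !res_comp.
    exists h', (exE _ _ _ h' ex').
    have e1 : app a (res l (res k x)) = res (idm W ∘ l) (ibase (s W (f ∘ k) h : isom W)).
      by rewrite comp1m sb app_res app_res ex !res_comp.
    have e2 : app a (res l (res k x)) = res l (ibase (s W (f ∘ k) h : isom W)).
      by rewrite e1 comp1m.
    rewrite (ieval_res e e1) (@ieval_hom _ _ _ _ l _ e1 e2); first by rewrite comp1m.
    have e3 : app a (res l (res k x)) = res (idm T) (ibase (s T (f ∘ k ∘ l) h1 : isom T)).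
      by rewrite res_id sb !app_res ex !res_comp.
    rewrite (comp _ _ _ _ _ h1 _ _ e3).
    move: h1 e3 h' ex' (exE _ _ _ h' ex'); rewrite -compmA => h1 e3 h' ex' e4.
    have Eh := proof_irrelevance _ h1 h'; subst h1.
    by apply: ieval_irr; rewrite res_comp.
  - move=> W k u v [h [e ->]] [h' [e' ->]].
    by have Eh := proof_irrelevance _ h h'; subst h'; apply: ieval_irr.
  - apply: (locally_imp _ (cf V f)) => W k h.
    have ex' : app a (res k x) = res (f ∘ k) y by rewrite app_res ex res_comp.
    by exists (ieval (s W (f ∘ k) h : isom W) (idm W) (res k x) (exE _ _ _ h ex')), h,
         (exE _ _ _ h ex').
  - exists z; split; first by move=> W k h e; apply: hz; exists h, e.
    by move=> z' hz'; apply: uz => W k u [h [e ->]]; apply: hz'. }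
pose F V (f : Hom V U) (x : A V) (ex : app a x = res f y) : A' V :=
  proj1_sig (constructive_indefinite_description _ (gl V f x ex)).
have FP V (f : Hom V U) x ex W (k : Hom W V) (h : mem R (f ∘ k)) e :
    res k (F V f x ex) = ieval (s W (f ∘ k) h : isom W) (idm W) (res k x) e.
  exact: (proj1 (proj2_sig (constructive_indefinite_description _ (gl V f x ex)))).
have exk V (f : Hom V U) (x : A V) W (k : Hom W V) (h : mem R (f ∘ k)) : app a x = res f y ->
    app a (res k x) = res (idm W) (ibase (s W (f ∘ k) h : isom W)).
  by move=> ex; rewrite res_id sb app_res ex res_comp.
have [m [mb mE]] : exists m : isom U, ibase m = y /\
    forall V (f : Hom V U) x e ex, ieval m f x e = F V f x ex.
{ unshelve refine (ex_intro _ (@mk_isom U y F _ _ _ _ _) (conj eq_refl _)).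
- move=> V f x ex; apply: sheaf_sep.
  apply: (locally_imp _ (cf V f)) => W k h.
  by rewrite -app_res (FP V f x ex W k h (exk _ _ _ _ _ h ex)) ieval_over res_id sb res_comp.
- move=> V W f k x ex ex'; apply: sheaf_sep.
  apply: (locally_imp _ (cf W (f ∘ k))) => T l h.
  have h' : mem R (f ∘ (k ∘ l)) by rewrite compmA.
  rewrite (FP W _ _ _ T l h (exk _ _ _ _ _ h ex')) -res_comp.
  rewrite (FP V f x ex T (k ∘ l) h' (exk _ _ _ _ _ h' ex)).
  move: h h' (exk _ _ _ _ _ h ex') (exk _ _ _ _ _ h' ex).
  rewrite -compmA => h h'; have Eh := proof_irrelevance _ h h'; subst h' => e1 e2.
  by apply: ieval_irr; rewrite res_comp.
- move=> V f g x ex ex'; apply: sheaf_sep.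
  apply: (locally_imp _ (cf V f)) => W k h.
  rewrite (FP V f _ ex' W k h (exk _ _ _ _ _ h ex')) [in RHS]res_act.
  rewrite (FP V f _ ex W k h (exk _ _ _ _ _ h ex)).
  have e : app a (res k g • res k x) = res (idm W) (ibase (s W (f ∘ k) h : isom W)).
    by rewrite a_inv; exact: (exk _ _ _ _ _ h ex).
  rewrite -(ieval_act _ e); apply: ieval_irr; exact: res_act.
- move=> V f x x' ex ex' E; apply: sheaf_sep.
  apply: (locally_imp _ (cf V f)) => W k h.
  have := f_equal (res k) E.
  rewrite (FP V f _ ex' W k h (exk _ _ _ _ _ h ex')).
  rewrite (FP V f _ ex W k h (exk _ _ _ _ _ h ex)).
  exact: ieval_inj.
- move=> V f z ez.
  have [|||x [hx _]] := @sheaf_glue C A V (fun W k x => exists (h : mem R (f ∘ k)) e,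
      ieval (s W (f ∘ k) h : isom W) (idm W) x e = res k z).
  + move=> W T k l x [h [e E]].
    have h1 : mem R (f ∘ k ∘ l) by apply: mem_comp.
    have h' : mem R (f ∘ (k ∘ l)) by rewrite compmA.
    have e1 : app a (res l x) = res (idm W ∘ l) (ibase (s W (f ∘ k) h : isom W)).
      by rewrite comp1m app_res e res_id.
    have e2 : app a (res l x) = res l (ibase (s W (f ∘ k) h : isom W)).
      by rewrite e1 comp1m.
    have e3 : app a (res l x) = res (idm T) (ibase (s T (f ∘ k ∘ l) h1 : isom T)).
      by rewrite res_id sb e2 sb !res_comp.
    have e4 : app a (res l x) = res (idm T) (ibase (s T (f ∘ (k ∘ l)) h' : isom T)).
      by rewrite res_id sb e2 sb !res_comp.
    exists h', e4; rewrite res_comp -E (ieval_res e e1).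
    rewrite (@ieval_hom _ _ _ _ l _ e1 e2); first by rewrite comp1m.
    rewrite (comp _ _ _ _ _ h1 _ _ e3).
    move: h1 e3 h' e4; rewrite -compmA => h1 e3 h' e4.
    by have Eh := proof_irrelevance _ h1 h'; subst h1; apply: ieval_irr.
  + move=> W k x x' [h [e E]] [h' [e' E']].
    have Eh := proof_irrelevance _ h h'; subst h'; rewrite -E' in E.
    exact: ieval_inj E.
  + apply: (locally_imp _ (cf V f)) => W k h.
    have e : app a' (res k z) = res (idm W) (ibase (s W (f ∘ k) h : isom W)).
      by rewrite res_id sb app_res ez res_comp.
    by have [x [e' E]] := ieval_surj e; exists x, h, e'.
  + have key W (k : Hom W V) (h : mem R (f ∘ k)) : exists e,
        ieval (s W (f ∘ k) h : isom W) (idm W) (res k x) e = res k z.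
      have e : app a' (res k z) = res (idm W) (ibase (s W (f ∘ k) h : isom W)).
        by rewrite res_id sb app_res ez res_comp.
      have [x' [e' E]] := ieval_surj e.
      have Ex : res k x = x' by apply: hx; exists h, e'.
      by subst x'; exists e'.
    have ex : app a x = res f y.
      apply: sheaf_sep; apply: (locally_imp _ (cf V f)) => W k h.
      by have [e _] := key W k h; rewrite -app_res e res_id sb res_comp.
    exists x, ex; apply: sheaf_sep; apply: (locally_imp _ (cf V f)) => W k h.
    have [e E] := key W k h.
    by rewrite (FP V f x ex W k h e).
- by move=> V f x e ex; rewrite (proof_irrelevance _ ex e). }
exists m => V f h; apply: isom_ext => [|W k x e e']; first by rewrite sb /= mb.
  have h' : mem R (f ∘ k) by apply: mem_comp.
  have e1 : app a x = res (f ∘ k) y by rewrite e /= res_comp mb.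
  have e2 : app a (res (idm W) x) = res (f ∘ k ∘ idm W) y by rewrite res_id compm1.
  have h2 : mem R (f ∘ k ∘ idm W) by rewrite compm1.
  have e3 := exk _ _ _ _ (idm W) h2 e1.
  have e4 : app a x = res (idm W) (ibase (s W (f ∘ k) h' : isom W)) by rewrite res_id sb.
  have e5 : app a x = res (f ∘ k) (ibase m) by rewrite mb.
  rewrite (isom_resE e e5) (mE _ _ _ _ e1) -[LHS]res_id (FP _ _ _ _ _ _ h2 e3) (comp _ _ _ _ _ h' _ _ e4).
  move: h2 e3; rewrite compm1 => h2 e3.
  by have Eh := proof_irrelevance _ h2 h'; subst h2; apply: ieval_irr; rewrite res_id.
Qed.

Definition isom_sheaf : sheaf C := Sheaf isom_sheaf_axiom.

Definition isom_base : isom_sheaf ~> B.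
Proof. by unshelve refine {| app := fun U (s : isom_sheaf U) => ibase (s : isom U) |}. Defined.

End Isom.

Arguments ieval {C sub G A A' B a a' a_inv a'_inv U} s {V} f x e.

(** * Twisting a free action by a point of the quotient *)

(* The map h ↦ h p from G to P, over the objects above V. *)
Definition orbit_map (C : site) (sub : subcanonical C) (G : group_object C) (P : gobject G)
    (V : C) (p : P V) :
  diag (left_mul G) (trivial_action G (yo sub V)) ~>
  diag P (trivial_action G (yo sub V)).
Proof.
unshelve refine {| app := fun W (z : (G × yo sub V) W) =>
  (fst z • res (snd z : Hom W V) p, snd z) : (P × yo sub V) W |}.
by move=> W T k [h l]; rewrite /= res_act res_comp.
Defined.

Lemma pullback_torsor (C : site) (sub : subcanonical C) (S : C) (S_term : is_terminal S)
    (H : group_object C) (X : gobject H) (Q : sheaf C) (q : X ~> Q)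
    (X_free : acts_freely X) (q_quot : is_quotient q) (g : yo sub S ~> Q) :
  is_torsor sub (pullback (proj1 q_quot) g).
Proof.
move=> U; have [u _] := S_term U.
apply: (locally_imp _ (quotient_surj q_quot (app g (u : yo sub S U)))) => V f [x Ex].
have Ep : app q x = app g (u ∘ f : yo sub S V) by rewrite Ex -app_res.
pose p : pullback (proj1 q_quot) g V := exist _ (x, u ∘ f : yo sub S V) Ep.
exists (orbit_map sub p); split; [|split] => //.
  by move=> W h [k l]; congr pair; exact: actM.
apply: bij_is_iso => W.
  move=> [h l] [h' l'] E.
  have El : l = l' := f_equal snd E; subst l'; congr pair.
  have {}E : h • res l x = h' • res l x := f_equal (fun z => fst (proj1_sig (fst z))) E.
  have [k [_ uk]] := quotient_free (x := res l x) (y := h • res l x) q_quot X_free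
    (eq_sym (proj1 q_quot _ _ _)).
  by rewrite -(uk h) // -(uk h').
move=> [[[x' v] e] l].
have Ev : v = u ∘ f ∘ l.
  have [w [_ uw]] := S_term W; by rewrite -(uw v) // -(uw (u ∘ f ∘ l)).
have E : app q (res (l : Hom W V) x) = app q x'.
  by rewrite [RHS]e app_res Ep -app_res /= Ev.
have [h [Eh _]] := quotient_free q_quot X_free E.
exists (h, l); congr pair; apply: sig_ext; congr pair => //.
Qed.

Section TwistedSpace.
Variables (C : site) (sub : subcanonical C) (H : group_object C) (P X : gobject H)
  (Q : sheaf C) (q : X ~> Q).
Hypotheses (P_torsor : is_torsor sub P) (q_inv : invariant q).

(* P_Q = P × Q, over Q by the second projection. *)
Definition const_over : gobject H := diag P (trivial_action H Q).
Definition const_over_map : const_over ~> Q := pr2 P Q.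
Lemma const_over_inv : invariant const_over_map. Proof. by []. Qed.

Notation tH := (twisted_group P_torsor (conj_ggroup H)).
Notation tX := (isom_sheaf sub const_over_inv q_inv).

Definition twisted_act_app (U : C) (z : (tH × tX) U) : tX U.
Proof.
case: z => t s.
unshelve refine (@mk_isom C sub H const_over X Q const_over_map q const_over_inv q_inv U
  (ibase (s : isom sub const_over_inv q_inv U))
  (fun V f (x : const_over V) e =>
     @ieval C sub H const_over X Q const_over_map q const_over_inv q_inv U s V f
       (taut (res f t) (fst x), snd x) e) _ _ _ _ _).
- by move=> V f x e; apply: ieval_over.
- move=> V W f k [p y] e e'.
  have e2 : app const_over_map (res k ((taut (res f t) p, y) : const_over V))
    = res (f ∘ k) (ibase (s : isom sub const_over_inv q_inv U)) by exact: e'.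
  rewrite (ieval_res (s := s) (x := ((taut (res f t) p, y) : const_over V)) e e2).
  by apply: ieval_irr; congr pair; rewrite res_comp; exact: res_taut.
- move=> V f h [p y] e e'.
  have e2 : app const_over_map (h • ((taut (res f t) p, y) : const_over V))
    = res f (ibase (s : isom sub const_over_inv q_inv U)) by exact: e.
  rewrite -(ieval_act (s := s) (x := ((taut (res f t) p, y) : const_over V)) e e2).
  by apply: ieval_irr; congr pair; exact: taut_act.
- move=> V f [p y] [p' y'] e e' /ieval_inj [E1 E2]; subst y'; congr pair.
  by rewrite -(taut1 P_torsor p) -(taut1 P_torsor p') -(mulgV (res f t)) !tautM E1.
- move=> V f z /ieval_surj [[p y] [e E]].
  exists (taut (res f t)^-1 p, y), e; rewrite -E; apply: ieval_irr; congr pair.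
  by rewrite -tautM mulVg taut1.
Defined.

Lemma twisted_actE (U : C) (t : tH U) (s : tX U) V (f : Hom V U) (x : const_over V) e e' :
  ieval (twisted_act_app (t, s)) f x e
  = @ieval C sub H const_over X Q const_over_map q const_over_inv q_inv U s V f
      (taut (res f t) (fst x), snd x) e'.
Proof. by apply: ieval_irr. Qed.

Lemma twisted_act_res (U V : C) (f : Hom V U) (z : (tH × tX) U) :
  twisted_act_app (res f z) = res f (twisted_act_app z).
Proof.
case: z => t s; apply: isom_ext => // W k x e e'.
have e1 : snd x = res k (res f (ibase (s : isom sub const_over_inv q_inv U))) by exact: e.
have e2 : snd x = res (f ∘ k) (ibase (s : isom sub const_over_inv q_inv U)).
  by rewrite res_comp.
rewrite [LHS](twisted_actE (t := res f t) (s := res f s) (x := x) e e1).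
rewrite [RHS](isom_resE (s := twisted_act_app (t, s)) e' e2).
rewrite [RHS](twisted_actE (x := x) e2 e2).
rewrite [LHS](isom_resE (s := s : isom sub const_over_inv q_inv U)
  (x := (taut (res k (res f t)) (fst x), snd x) : const_over W) e1 e2).
by apply: ieval_irr; rewrite res_comp.
Qed.

Lemma twisted_act1 (U : C) (s : tX U) : twisted_act_app (1 : tH U, s) = s.
Proof.
apply: isom_ext => // V f x e e'.
rewrite (twisted_actE (t := 1) (s := s) e e).
by apply: ieval_irr; case: x e e' => p y _ _; rewrite res_oneg taut1.
Qed.

Lemma twisted_actM (U : C) (t t' : tH U) (s : tX U) :
  twisted_act_app (t * t', s) = twisted_act_app (t, twisted_act_app (t', s)).
Proof.
apply: isom_ext => // V f x e e'.
rewrite (twisted_actE (t := t * t') (s := s) e e).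
rewrite (twisted_actE (t := t) (s := twisted_act_app (t', s)) e' e').
pose x' := (taut (res f t) (fst x), snd x) : const_over V.
rewrite (twisted_actE (t := t') (s := s) (x := x') e' e').
by apply: ieval_irr; rewrite res_mulg tautM.
Qed.

(* The action of P ∧^H H on Isom(P_Q, X) by precomposition with the automorphisms
   of P; a left action since Aut(P) is the opposite group. *)
Definition twisted_space : gobject tH :=
  @GObject C tH tX (Mor twisted_act_res) twisted_act1 twisted_actM.

Definition twisted_space_map : twisted_space ~> Q := isom_base sub const_over_inv q_inv.

End TwistedSpace.

Definition geometric_origin (C : site) (sub : subcanonical C) (S : C)
    (H : group_object C) (X : gobject H) (Q : sheaf C) (q : X ~> Q)
    (q_quot : is_quotient q) (g : yo sub S ~> Q) : Prop :=
  trivial_torsor (pullback (proj1 q_quot) g).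

(* Main.v *)
Require Import Defs.
From Stdlib Require Import ssreflect ClassicalEpsilon.

(** A point of Q is of geometric origin as soon as it lifts to the total space,
    so what is needed is an isomorphism P_Q ~> X over the point g.  Over g the
    object X becomes X ×_Q S, and this is P by definition: the identity of P,
    that is, the projection P ~> X, is the required section of the twisted
    space ([twisted_space_lift]).

    Before that, the twisted space has to be a free quotient presentation of Q.
    Since P is a torsor, an equivariant isomorphism s out of P_Q over a section
    of Q is determined by that section and by its value [isom_at s p] at one
    point p of P, and p exists locally.  All claims are read off from this
    value.  The twisted group acts by precomposition, and p ∧ h sends p to hp,
    so it sends s(p) to s(hp) = h s(p).  Hence:
    - an element fixing s fixes every p, as s is injective, and is trivial
      ([twisted_space_free]);
    - if s and t lie over the same section of Q, then t(p) = h s(p) for some h,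
      because X has quotient Q, and p ∧ h sends s to t
      ([twisted_space_orbit]);
    - a section of Q lifts locally to a point x of X, and hp ↦ hx is then an
      isomorphism over it, as H acts freely on X ([isom_over_section]). *)

Set Implicit Arguments.
Unset Strict Implicit.
Unset Printing Implicit Defensive.
Local Open Scope grp_scope.

(** * Quotient maps and lifts of points *)

(** A map that is locally surjective descends everything constant on its fibres,
    and when the fibres are orbits this means every invariant map. *)
Lemma is_quotientI (C : site) (G : group_object C) (X : gobject G) (Q : sheaf C)
    (q : X ~> Q) :
  invariant q ->
  (forall U (b : Q U), locally (fun V (f : Hom V U) => exists x, app q x = res f b)) ->
  (forall U (x y : X U), app q x = app q y -> same_orbit x y) ->
  is_quotient q.
Proof.
move=> q_inv q_surj q_orbit; split=> // Z h h_inv.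
have h_wd U (x y : X U) : app q x = app q y -> app h x = app h y.
  by move/q_orbit; apply: same_orbit_inv.
exists (descend q_surj h_wd); split.
  by apply: mor_ext => U x; exact: (descendE q_surj h_wd x).
move=> m Em; apply: mor_ext => U b; apply: sheaf_sep.
apply: (locally_imp _ (q_surj U b)) => V f [x Ex].
rewrite -!app_res -Ex (descendE q_surj h_wd x).
by rewrite -[RHS]/(app (mcomp m q) x) Em.
Qed.

Lemma terminal_eq (C : category) (S : C) (S_term : is_terminal S) (U : C) (u v : Hom U S) :
  u = v.
Proof. by have [w [_ uw]] := S_term U; rewrite -(uw u) // -(uw v). Qed.

(** The lift x gives a point p = (x, id) of the pullback over S, which can be
    restricted to any U because S is terminal.  The orbit map h ↦ hp is then
    bijective, the action on each fibre of q being free and transitive. *)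
Lemma lift_geometric_origin (C : site) (sub : subcanonical C) (S : C)
    (S_term : is_terminal S) (G : group_object C) (X : gobject G)
    (X_free : acts_freely X) (Q : sheaf C) (q : X ~> Q) (q_quot : is_quotient q)
    (g : yo sub S ~> Q) (x : X S) :
  app q x = app g (idm S : yo sub S S) -> geometric_origin q_quot g.
Proof.
move=> Ex.
pose to_S U : Hom U S := proj1_sig (constructive_indefinite_description _ (S_term U)).
pose p : pullback (proj1 q_quot) g S := exist _ (x, idm S : yo sub S S) Ex.
have p_nat U V (f : Hom V U) (h : G U) :
    res f h • res (to_S V) p = res f (h • res (to_S U) p).
  by rewrite res_act -res_comp (terminal_eq S_term (to_S V) (to_S U ∘ f)).
exists (Mor (X := left_mul G) (Y := pullback (proj1 q_quot) g)
  (app := fun U (h : G U) => h • res (to_S U) p) p_nat); split.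
  by move=> U h k; exact: actM.
apply: bij_is_iso => U /=.
  move=> h k /(f_equal (fun z => fst (proj1_sig z))) E.
  have {}E : h • res (to_S U) x = k • res (to_S U) x := E.
  have [l [_ ul]] := quotient_free (x := res (to_S U) x) q_quot X_free
    (eq_sym (proj1 q_quot _ h _)).
  by rewrite -(ul h) // -(ul k).
move=> [[y u] e].
have E : app q (res (to_S U) x) = app q y.
  rewrite app_res Ex -app_res [RHS]e; congr (app g _).
  exact: terminal_eq.
have [h [Eh _]] := quotient_free q_quot X_free E.
exists h; apply: sig_ext; congr pair; [by rewrite Eh | exact: terminal_eq].
Qed.

(** * Equivariant isomorphisms out of a torsor *)

Section IsomAt.
Variables (C : site) (sub : subcanonical C) (H : group_object C) (P X : gobject H)
  (Q : sheaf C) (q : X ~> Q).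
Hypotheses (P_torsor : is_torsor sub P) (q_inv : invariant q).

Notation tH := (twisted_group P_torsor (conj_ggroup H)).
Notation tX := (twisted_space P_torsor q_inv).
Notation tq := (twisted_space_map P_torsor q_inv).
Notation PQ := (const_over P Q).
Notation isomQ := (isom sub (@const_over_inv C H P Q) q_inv).

(** Over U itself the argument of s in P_Q can only be (p, y), where y is the
    base point of s; so s amounts to y together with a map on P, and the proofs
    of compatibility carried by [ieval] can be hidden. *)
Definition isom_at (U : C) (s : isomQ U) (p : P U) : X U :=
  ieval s (idm U) ((p, ibase s) : PQ U) (eq_res_id eq_refl).

Lemma isom_atE U (s : isomQ U) V (f : Hom V U) (x : PQ V) e :
  ieval s f x e = isom_at (isom_res f s) (fst x).
Proof.
have e1 : app (const_over_map P Q) ((fst x, res f (ibase s)) : PQ V)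
    = res (f ∘ idm V) (ibase s) by rewrite compm1.
rewrite /isom_at (isom_resE _ e1).
move: e1; rewrite compm1 => e1; apply: ieval_irr.
by case: x e e1 => p b e e1; congr pair; exact: e.
Qed.

Lemma isom_at_over U (s : isomQ U) (p : P U) : app q (isom_at s p) = ibase s.
Proof. by rewrite /isom_at ieval_over res_id. Qed.

Lemma isom_at_act U (s : isomQ U) (h : H U) (p : P U) :
  isom_at s (h • p) = h • isom_at s p.
Proof.
have e : app (const_over_map P Q) (h • ((p, ibase s) : PQ U)) = res (idm U) (ibase s).
  by rewrite res_id.
by rewrite /isom_at -(ieval_act _ e); apply: ieval_irr.
Qed.

Lemma isom_at_inj U (s : isomQ U) (p p' : P U) : isom_at s p = isom_at s p' -> p = p'.
Proof. by move/ieval_inj => [E]. Qed.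

Lemma isom_at_twisted U (t : tH U) (s : tX U) (p : P U) :
  isom_at (t • s : tX U) p = isom_at s (taut t p).
Proof.
have e : app (const_over_map P Q)
    ((taut t p, ibase (s : isomQ U)) : PQ U) = res (idm U) (ibase (s : isomQ U)).
  by rewrite res_id.
rewrite /isom_at.
rewrite [LHS](twisted_actE (t := t) (s := s)
  (x := ((p, ibase (s : isomQ U)) : PQ U)) _ e).
by apply: ieval_irr; rewrite res_id.
Qed.

(** Any point of P over V is a translate of the restriction of p, so its image is
    forced by equivariance. *)
Lemma isom_eq_at U (s t : isomQ U) (p : P U) :
  ibase s = ibase t -> isom_at s p = isom_at t p -> s = t.
Proof.
move=> Eb Ep; apply: isom_ext => // V f x e e'; rewrite !isom_atE.
have [h ->] := torsor_trans P_torsor (res f p) (fst x).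
rewrite !isom_at_act; congr (_ • _).
have at_res (r : isomQ U) : isom_at (isom_res f r) (res f p) = res f (isom_at r p).
  have e1 : app (const_over_map P Q) (res f ((p, ibase r) : PQ U))
      = res (idm U ∘ f) (ibase r) by rewrite comp1m.
  rewrite [RHS](ieval_res _ e1).
  by move: e1; rewrite comp1m => e1; rewrite isom_atE.
by rewrite !at_res Ep.
Qed.

(** Since s is injective, it can be cancelled from s ∘ t = s; and an automorphism
    p ∧ h of P fixing p has h = 1 because P is a torsor. *)
Lemma twisted_space_free : acts_freely tX.
Proof.
move=> U t s E; apply: sheaf_sep.
apply: (locally_bind (torsor_ex P_torsor U)) => V f [p _].
apply: (locally_imp _ (wedge_at P_torsor (res f t : twist P (ggobj (conj_ggroup H)) V) p)).
move=> W k [h Eh].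
have {}Eh : res (f ∘ k) t = wedge (Z := ggobj (conj_ggroup H)) (res k p) h :> tH W.
  by rewrite res_comp.
have Ep : taut (res (f ∘ k) t) (res k p) = res k p.
  apply: (@isom_at_inj _ (res (f ∘ k) s : tX W)).
  by rewrite -isom_at_twisted -res_act E.
rewrite Eh tautE in Ep.
rewrite Eh (torsor_free P_torsor Ep) res_oneg.
by symmetry; exact: twist_oneE.
Qed.

Hypotheses (X_free : acts_freely X) (q_quot : is_quotient q).

(** The element carrying s to t is p ∧ h, where h carries s(p) to t(p). *)
Lemma twisted_space_orbit U (s t : tX U) : app tq s = app tq t -> same_orbit s t.
Proof.
move=> Eb; apply: (locally_imp _ (torsor_ex P_torsor U)) => V f [p _].
have {}Eb : ibase (res f s : tX V) = ibase (res f t : tX V) :> Q V.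
  exact: (f_equal (res f) Eb).
have Eq : app q (isom_at (res f s) p) = app q (isom_at (res f t) p).
  by rewrite !isom_at_over.
have [h [Eh _]] := quotient_free q_quot X_free Eq.
exists (wedge (Z := ggobj (conj_ggroup H)) p h).
apply: (isom_eq_at (p := p)) => //.
by rewrite isom_at_twisted tautE isom_at_act.
Qed.

(** The isomorphism is h p0 ↦ h x0.  It is well defined and natural because H acts
    simply transitively on P, and bijective because H acts simply transitively on
    the fibres of q. *)
Lemma isom_over_section U (p0 : P U) (x0 : X U) : exists s : tX U, app tq s = app q x0.
Proof.
(* The coefficient h is chosen; by freeness of P the choice is the only one
   possible, and [FE] lets one forget how it was made. *)
pose F V (f : Hom V U) (z : PQ V)
    (e : app (const_over_map P Q) z = res f (app q x0)) : X V :=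
  proj1_sig (constructive_indefinite_description _
    (torsor_trans P_torsor (res f p0) (fst z))) • res f x0.
have FE V (f : Hom V U) (h : H V) b e : F V f ((h • res f p0, b) : PQ V) e = h • res f x0.
  rewrite /F; case: constructive_indefinite_description => k /= Ek.
  by rewrite (torsor_inj P_torsor Ek).
unshelve refine (ex_intro _ (@mk_isom C sub H PQ X Q (const_over_map P Q) q
  (@const_over_inv C H P Q) q_inv U (app q x0) F _ _ _ _ _) eq_refl).
- by move=> V f z e; rewrite /F q_inv app_res.
- move=> V W f k [p b] e e'.
  have [h Eh] := torsor_trans P_torsor (res f p0) p; subst p.
  rewrite FE.
  move: e'; rewrite -[res k _]/((res k (h • res f p0), res k b) : PQ W).
  by rewrite !res_act -!res_comp => e'; rewrite FE.
- move=> V f g [p b] e e'.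
  have [h Eh] := torsor_trans P_torsor (res f p0) p; subst p.
  rewrite FE; move: e'; rewrite -[g • _]/((g • (h • res f p0), b) : PQ V).
  by rewrite -!actM => e'; rewrite FE.
- move=> V f [p b] [p' b'] e e'.
  have [h Eh] := torsor_trans P_torsor (res f p0) p.
  have [h' Eh'] := torsor_trans P_torsor (res f p0) p'; subst p p'.
  rewrite !FE => E.
  have Eb : b = b' by transitivity (res f (app q x0)); [exact: e | symmetry; exact: e'].
  have [l [_ ul]] := quotient_free (x := res f x0) q_quot X_free
    (eq_sym (q_inv h (res f x0))).
  by rewrite Eb -(ul h) // -(ul h').
- move=> V f z e.
  have Ez : app q (res f x0) = app q z by rewrite app_res e.
  have [h [-> _]] := quotient_free q_quot X_free Ez.
  have eh : app (const_over_map P Q) ((h • res f p0, res f (app q x0)) : PQ V)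
    = res f (app q x0) by [].
  by exists ((h • res f p0, res f (app q x0)) : PQ V), eh; rewrite FE.
Qed.

Lemma twisted_space_surj U (b : Q U) :
  locally (fun V (f : Hom V U) => exists s, app tq s = res f b).
Proof.
apply: (locally_bind (quotient_surj q_quot b)) => V f [x Ex].
apply: (locally_imp _ (torsor_ex P_torsor V)) => W k [p _].
have [s Es] := isom_over_section p (res k x).
by exists s; rewrite Es app_res Ex res_comp.
Qed.

Lemma twisted_space_quotient : is_quotient tq.
Proof.
apply: is_quotientI => //; first exact: twisted_space_surj.
exact: twisted_space_orbit.
Qed.

End IsomAt.

(** * The tautological isomorphism at the given point *)

(** The isomorphism sends ((x, u), b) to x.  It is onto the fibre of X over g
    because a point z of that fibre over V is the image of (z, f), f being the
    one map from V to S. *)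
Lemma twisted_space_lift (C : site) (sub : subcanonical C) (S : C)
    (S_term : is_terminal S) (H : group_object C) (X : gobject H) (Q : sheaf C)
    (q : X ~> Q) (q_inv : invariant q) (g : yo sub S ~> Q)
    (P_torsor : is_torsor sub (pullback q_inv g)) :
  exists s : twisted_space P_torsor q_inv S,
    app (twisted_space_map P_torsor q_inv) s = app g (idm S : yo sub S S).
Proof.
pose P := pullback q_inv g; pose y : Q S := app g (idm S : yo sub S S).
have gE V (u : yo sub S V) f : app g u = res f y.
  by rewrite /y -app_res; congr (app g _); exact: terminal_eq.
pose F V (f : Hom V S) (z : const_over P Q V)
    (_ : app (const_over_map P Q) z = res f y) : X V := fst (proj1_sig (fst z)).
unshelve refine (ex_intro _ (@mk_isom C sub H (const_over P Q) X Q (const_over_map P Q) q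
  (@const_over_inv C H P Q) q_inv S y F _ _ _ _ _) eq_refl) => //.
- by move=> V f [[[x u] e] b] eb; rewrite -(gE V u f).
- move=> V f [[[x u] e] b] [[[x' u'] e'] b'] eb eb' E.
  have {}E : x = x' := E; have Eu : u = u' := terminal_eq S_term u u'.
  congr pair; first by apply: sig_ext; rewrite /= E Eu.
  by transitivity (res f y); [exact: eb | symmetry; exact: eb'].
- move=> V f z Ez.
  have e : app q z = app g (f : yo sub S V) by rewrite (gE V f f).
  by exists ((exist _ (z, f : yo sub S V) e : P V, res f y) : const_over P Q V), eq_refl.
Qed.

Theorem theorem1p2 (C : site) (S : C) (S_terminal : is_terminal S)
    (C_fiber_products : has_fiber_products C) (sub : subcanonical C)
    (H : group_object C) (X : gobject H) (X_free : acts_freely X)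
    (Q : sheaf C) (q : X ~> Q) (q_quot : is_quotient q) (g : yo sub S ~> Q) :
  let P : gobject H := pullback (proj1 q_quot) g in
  let P_torsor : is_torsor sub P := pullback_torsor S_terminal X_free q_quot g in
  let tH : group_object C := twisted_group P_torsor (conj_ggroup H) in
  let tX : gobject tH := twisted_space P_torsor (proj1 q_quot) in
  let tq : tX ~> Q := twisted_space_map P_torsor (proj1 q_quot) in
  acts_freely tX /\
  exists tq_quot : is_quotient tq, geometric_origin tq_quot g.
Proof.
move=> P P_torsor tH tX tq.
have tX_free : acts_freely tX by exact: twisted_space_free.
split=> //.
exists (twisted_space_quotient P_torsor (proj1 q_quot) X_free q_quot).
have [s Es] := twisted_space_lift S_terminal P_torsor.
exact: (lift_geometric_origin S_terminal tX_free _ Es).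
Qed.
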